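(* Assume that $\phi\in C^1(X,G)$ and that $\phi$ has nonzero degree $P_\phi M_\phi$, that is, $P_\phi M_\phi\ne0$ on a set $X_0\subset X$ with $\mu_X(X_0)>0$. (a) If $\int_Xd\mu_X(x)\,M_\phi(x)\in\big(\mathfrak g^{\mathrm{Ad}}\big)^\perp$, then $T_\phi$ is not uniquely ergodic. (b) If $G$ is connected and $z(\mathfrak g)=\{0\}$, then $T_\phi$ is not uniquely ergodic. (c) If the assumptions of (a) or (b) are satisfied and if $F_1$ is uniquely ergodic, then $T_\phi$ is not ergodic (with respect to $\mu_X\otimes\mu_G$).
   Context: $X$ is a smooth compact second countable Hausdorff manifold with Borel probability measure $\mu_X$, and $\{F_t\}_{t\in\mathbb R}$ is a $C^1$ flow on $X$ preserving $\mu_X$, with continuous vector field $Y$; $\mathcal L_Yf(x)=\frac{d}{dt}|_{t=0}f(F_t(x))$. $G$ is a compact Lie group with normalised Haar measure $\mu_G$ and Lie algebra $\mathfrak g$, endowed with an $\mathrm{Ad}$-invariant scalar product $\langle\cdot,\cdot\rangle_{\mathfrak g}$, where $\mathrm{Ad}_gZ=gZg^{-1}$. $T_\phi:X\times G\to X\times G$, $T_\phi(x,g)=(F_1(x),g\phi(x))$. ''$F_1$ uniquely ergodic'' (resp. ''$T_\phi$ uniquely ergodic'') means that $\mu_X$ (resp. $\mu_X\otimes\mu_G$) is the only invariant Borel probability measure. $M_\phi:=\mathcal L_Y\phi\cdot\phi^{-1}:X\to\mathfrak g$ (right translation to the tangent space at the identity). $L^2(X,\mathfrak g)$ is the Hilbert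 space of measurable functions $X\to\mathfrak g$ with scalar product $\int_Xd\mu_X\langle f_1,f_2\rangle_{\mathfrak g}$; $W_\phi$ is the unitary operator in it given by $(W_\phi f)(x)=\mathrm{Ad}_{\phi(x)}f(F_1(x))$; $P_\phi$ is the orthogonal projection onto $\ker(1-W_\phi)$; $P_\phi M_\phi$ is called the degree of $\phi$. $\mathfrak g^{\mathrm{Ad}}:=\{Z\in\mathfrak g:\mathrm{Ad}_gZ=Z\ \forall g\in G\}$, $(\mathfrak g^{\mathrm{Ad}})^\perp$ is its orthocomplement in $\mathfrak g$, and $z(\mathfrak g)$ is the center of the Lie algebra $\mathfrak g$. *)

(* Defs.v *)
From HB Require Import structures.
From mathcomp Require Import all_boot all_order all_algebra.
From mathcomp Require Import all_classical all_reals all_analysis.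

Set Implicit Arguments.
Unset Strict Implicit.
Unset Printing Implicit Defensive.

Import Order.TTheory GRing.Theory Num.Theory.
Import numFieldNormedType.Exports.

Local Open Scope classical_set_scope.
Local Open Scope ring_scope.

(* A type carrying both a group structure and a topology; the compatibility of
   the two is part of [lie_group] below.  The distinguished point is only there
   because measurable types are pointed, and plays no other role. *)
#[short(type="pointedTopGroupType")]
HB.structure Definition PointedTopGroup :=
  {G of Group G & PointedTopological G}.

Section Manifolds.
Variable R : realType.

Fixpoint Ck_on (V W : normedModType R) (k : nat) (U : set V) (f : V -> W)
    : Prop :=
  match k with
  | 0 => forall x, U x -> {for x, continuous f}
  | k'.+1 => (forall x, U x -> differentiable f x) /\
             (forall v : V, Ck_on k' U (fun x => 'd f x v))
  end.

(* [chart_fun] is only meaningful on [chart_dom], and [chart_inv] on the image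
   of [chart_dom]. *)
Record chart (n : nat) (M : Type) := Chart {
  chart_dom : set M;
  chart_fun : M -> 'rV[R]_n;
  chart_inv : 'rV[R]_n -> M }.

Definition is_chart (n : nat) (M : topologicalType) (c : chart n M) : Prop :=
  [/\ open (chart_dom c),
      open (chart_fun c @` chart_dom c),
      (forall x, chart_dom c x -> chart_inv c (chart_fun c x) = x),
      (forall x, chart_dom c x -> {for x, continuous (chart_fun c)}) &
      (forall v, (chart_fun c @` chart_dom c) v ->
        {for v, continuous (chart_inv c)})].

Definition smooth_atlas (n : nat) (M : topologicalType)
    (A : set (chart n M)) : Prop :=
  [/\ (forall c, A c -> is_chart c),
      (forall x, exists2 c, A c & chart_dom c x) &
      (forall c d, A c -> A d -> forall k,
        Ck_on k (chart_fun c @` (chart_dom c `&` chart_dom d))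
          (chart_fun d \o chart_inv c))].

Definition smooth_manifold (n : nat) (M : topologicalType)
    (A : set (chart n M)) : Prop :=
  [/\ smooth_atlas A, hausdorff_space M & @second_countable M].

Definition Ck_map (n m : nat) (M N : topologicalType) (k : nat)
    (A : set (chart n M)) (B : set (chart m N)) (f : M -> N) : Prop :=
  continuous f /\
  forall c d, A c -> B d ->
    Ck_on k (chart_fun c @` (chart_dom c `&` f @^-1` chart_dom d))
      (chart_fun d \o f \o chart_inv c).

Definition smooth_map (n m : nat) (M N : topologicalType)
    (A : set (chart n M)) (B : set (chart m N)) (f : M -> N) : Prop :=
  forall k, Ck_map k A B f.

Definition line_atlas : set (chart 1 R) :=
  [set Chart [set: R] (fun t => const_mx t) (fun v => v ord0 ord0)].

Definition prod_chart (n m : nat) (M N : Type) (c : chart n M) (d : chart m N)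
    : chart (n + m) (M * N) :=
  Chart (chart_dom c `*` chart_dom d)
    (fun p => row_mx (chart_fun c p.1) (chart_fun d p.2))
    (fun v => (chart_inv c (lsubmx v), chart_inv d (rsubmx v))).

Definition prod_atlas (n m : nat) (M N : Type)
    (A : set (chart n M)) (B : set (chart m N)) : set (chart (n + m) (M * N)) :=
  [set prod_chart c d | c in A & d in B].

(* A tangent vector acts on functions by differentiation.  It is represented by
   this action, set to 0 on the functions that are not smooth, so that two
   tangent vectors at a point are equal iff they agree on all smooth
   functions. *)
Definition functional (M : Type) := (M -> R) -> R^o.

Definition velocity (n : nat) (M : topologicalType) (A : set (chart n M))
    (gamma : R -> M) : functional M :=
  fun f => if `[< smooth_map A line_atlas f >]
           then derive1 (f \o gamma : R -> R^o) 0 else 0.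

Definition tangent_space (n : nat) (M : topologicalType) (A : set (chart n M))
    (p : M) : set (functional M) :=
  [set velocity A gamma | gamma in
    [set gamma | Ck_map 1 line_atlas A gamma /\ gamma 0 = p]].

(* The differential of [h], when [h] is a diffeomorphism. *)
Definition pushforward (M : Type) (h : M -> M) (Z : functional M)
  : functional M := fun f => Z (f \o h).

End Manifolds.

Section LieGroups.
Variables (R : realType) (d : nat) (G : pointedTopGroupType).
Variable AG : set (chart R d G).

Definition lie_group : Prop :=
  [/\ smooth_manifold AG,
      smooth_map (prod_atlas AG AG) AG (fun p : G * G => (p.1 * p.2)%g) &
      smooth_map AG AG (fun g : G => g^-1%g)].

Definition lie_algebra : set (functional R G) := tangent_space AG 1%g.

Definition Ad (g : G) : functional R G -> functional R G :=
  pushforward (fun h : G => (g * h * g^-1)%g).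

(* For [Z] tangent at the identity, [fun g => Z (fun h => f (g * h))] is the
   derivative of [f] along the left invariant vector field extending [Z]; the
   bracket below is the value at the identity of the commutator of the two left
   invariant vector fields. *)
Definition lie_bracket (Z W : functional R G) : functional R G := fun f =>
  Z (fun g => W (fun h => f (g * h)%g)) - W (fun g => Z (fun h => f (g * h)%g)).

Definition lie_center : set (functional R G) :=
  [set Z | lie_algebra Z /\ forall W, lie_algebra W -> lie_bracket Z W = 0].

Definition Ad_fixed : set (functional R G) :=
  [set Z | lie_algebra Z /\ forall g, Ad g Z = Z].

Definition scalar_product (ip : functional R G -> functional R G -> R) : Prop :=
  [/\ (forall Z W, lie_algebra Z -> lie_algebra W -> ip Z W = ip W Z),
      (forall a Z1 Z2 W, lie_algebra Z1 -> lie_algebra Z2 -> lie_algebra W ->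
        ip (a *: Z1 + Z2) W = a * ip Z1 W + ip Z2 W) &
      (forall Z, lie_algebra Z -> Z <> 0 -> 0 < ip Z Z)].

Definition Ad_invariant (ip : functional R G -> functional R G -> R) : Prop :=
  forall g Z W, lie_algebra Z -> lie_algebra W -> ip (Ad g Z) (Ad g W) = ip Z W.

Definition orthocomplement (ip : functional R G -> functional R G -> R)
    (S : set (functional R G)) : set (functional R G) :=
  [set Z | lie_algebra Z /\ forall W, S W -> ip Z W = 0].

End LieGroups.

(* The Borel sigma-algebra; on a product of second countable spaces the product
   of the Borel sigma-algebras is the Borel sigma-algebra of the product. *)
Notation borel T := (g_sigma_algebraType (@open T)).

Section Dynamics.
Context {R : realType} {dT : measure_display} {T : measurableType dT}.

Definition invariant_measure (f : T -> T) (m : set T -> \bar R) : Prop :=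
  forall A, measurable A -> m (f @^-1` A) = m A.

Definition uniquely_ergodic (f : T -> T) (m : set T -> \bar R) : Prop :=
  invariant_measure f m /\
  forall P : probability T R, invariant_measure f P ->
    forall A, measurable A -> P A = m A.

Definition ergodic (f : T -> T) (m : set T -> \bar R) : Prop :=
  forall A, measurable A -> f @^-1` A = A -> m A = 0%E \/ m A = 1%E.

End Dynamics.

Definition C1_flow (R : realType) (n : nat) (X : topologicalType)
    (AX : set (chart R n X)) (F : R -> X -> X) : Prop :=
  [/\ (forall x, F 0 x = x),
      (forall s t x, F (s + t) x = F s (F t x)) &
      Ck_map 1 (prod_atlas (@line_atlas R) AX) AX
        (fun p : R * X => F p.1 p.2)].

(* On a compact group the left invariant probability measure is also right
   invariant. *)
Definition normalised_haar (R : realType) (G : pointedTopGroupType)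
    (mu : probability (borel G) R) : Prop :=
  forall (g : G) (A : set (borel G)), measurable A ->
    mu [set (g * h)%g | h in (A : set G)] = mu A.

Section Cocycle.
Variables (R : realType) (X : ptopologicalType) (muX : probability (borel X) R).
Variables (d : nat) (G : pointedTopGroupType) (AG : set (chart R d G)).
Variable ip : functional R G -> functional R G -> R.
Variables (F : R -> X -> X) (phi : X -> G).

Definition skew_product (p : borel X * borel G) : borel X * borel G :=
  (F 1 p.1, ((p.2 : G) * phi p.1)%g).

(* The vector field derivative of [phi] at [x], tangent to [G] at [phi x]. *)
Definition lie_derivative (x : X) : functional R G :=
  velocity AG (fun t => phi (F t x)).

Definition M_cocycle (x : X) : functional R G :=
  pushforward (fun g : G => (g * (phi x)^-1)%g) (lie_derivative x).

(* The evaluations [Z |-> Z f] span the dual of the Lie algebra: measurability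
   and integration of Lie algebra valued functions can be tested on them. *)
Definition L2 (f : X -> functional R G) : Prop :=
  [/\ (forall x, lie_algebra AG (f x)),
      (forall u : G -> R,
        measurable_fun [set: borel X] (fun x : borel X => f x u : R)) &
      (\int[muX]_x (ip (f x) (f x))%:E < +oo)%E].

Definition L2_dot (f1 f2 : X -> functional R G) : R :=
  Rintegral muX [set: borel X] (fun x => ip (f1 x) (f2 x)).

Definition vector_integral (f : X -> functional R G) : functional R G :=
  fun u => Rintegral muX [set: borel X] (fun x => f x u : R).

Definition W_op (f : X -> functional R G) : X -> functional R G :=
  fun x => Ad (phi x) (f (F 1 x)).

Definition ker_one_minus_W : set (X -> functional R G) :=
  [set f | L2 f /\ {ae muX, forall x, W_op f x = f x}].

(* [p] represents the orthogonal projection of [f] onto [K]; elements of L2 are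
   represented by functions, the projection being unique up to null sets. *)
Definition is_orthogonal_projection (K : set (X -> functional R G))
    (f p : X -> functional R G) : Prop :=
  K p /\ forall h, K h -> L2_dot (f - p) h = 0.

Definition is_degree (p : X -> functional R G) : Prop :=
  is_orthogonal_projection ker_one_minus_W M_cocycle p.

Definition nonzero_on_positive_measure (p : X -> functional R G) : Prop :=
  exists X0 : set (borel X),
    [/\ measurable X0, (0 < muX X0)%E & forall x, X0 x -> p x <> 0].

End Cocycle.

(* Main.v *)
From HB Require Import structures.
Require Import Defs.
From mathcomp Require Import all_boot all_order all_algebra.
From mathcomp Require Import all_classical all_reals all_analysis.
From mathcomp Require Import measurable_realfun ring.

(** Write p for the degree of phi, W for W_phi and T for T_phi. Since W p = p almost
    everywhere, the map (x, g) |-> Ad_g (p x) is invariant under T: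
      Ad_(g phi(x)) (p (F_1 x)) = Ad_g ((W p) x) = Ad_g (p x).
    If T is ergodic, this map is therefore almost everywhere equal to a constant c. By
    invariance of Haar measure, for every k there is g with Ad_g (p x) = c and
    Ad_(k g) (p x) = c at once, so Ad_k c = c; thus c is fixed by Ad and p x = c for almost
    every x. This is [ergodic_cocycle_invariant_constant]. As p is nonzero on a set of
    positive measure, c is not 0.

    Unique ergodicity implies ergodicity ([uniquely_ergodic_ergodic]), so all three parts
    follow from a contradiction between the existence of c and the assumption (a) or (b).

    Under (a), the constant function c belongs to the kernel of 1 - W, so it is orthogonal to
    M - p, which means that the scalar product of c with the mean of M is the square of the
    norm of c ([constant_projection_norm]). The mean of M is orthogonal to the Ad-fixed
    vectors, hence c = 0.

    Under (b), a vector Z fixed by Ad is central ([Ad_fixed_center]): its bracket with a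
    vector Z' compares the two orders of differentiation of f (gamma(s) sigma(t)), where
    gamma and sigma are curves with velocities Z and Z', so it vanishes by symmetry of
    second derivatives ([schwarz]). The centre being trivial, c = 0.

    Three facts about manifolds connect these arguments to real analysis. The tangent space
    is finite dimensional with coordinates given by evaluation on finitely many functions
    ([tangent_space_basis]), which turns statements about Lie algebra valued functions into
    statements about real functions. Every tangent vector is the velocity of a smooth curve
    ([smooth_curve_exists]). The derivative at t = 0 of a function of class C^(k+1) on M x R
    is of class C^k on M ([Ck_fun_partial]); this gives the continuity of M_phi, hence its
    integrability on the compact manifold X, the continuity of Ad_g Z in g, and the smoothness of
    the functions inside the bracket. *)

Set Implicit Arguments.
Unset Strict Implicit.
Unset Printing Implicit Defensive.

Import Order.TTheory GRing.Theory Num.Theory.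
Import numFieldNormedType.Exports.

Local Open Scope classical_set_scope.
Local Open Scope ring_scope.

(** * Calculus of C^k maps on open sets *)

Section Calculus.
Context {R : realType}.
Implicit Types U V W : normedModType R.

Lemma near_eq_diff V W (f g : V -> W) x :
  (\near x, f x = g x) -> differentiable f x ->
  differentiable g x /\ ('d g x : V -> W) = 'd f x.
Proof.
move=> fg /diff_locallyP[df_cont f_eq].
have fgx : f x = g x by exact: nbhs_singleton fg.
have g_eq : g \o shift x = cst (g x) + 'd f x +o_ 0 id.
  apply/eqaddoP => e e0; move/eqaddoP: f_eq => /(_ e e0) f_eq.
  have fg0 : \forall y \near (0 : V), f (y + x) = g (y + x).
    by move: fg; rewrite (near_shift 0 x) /=; apply: filterS => y; rewrite /= subr0.
  move: f_eq fg0; apply: filterS2 => y + fgy.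
  by rewrite !fctE /= fgy fgx.
split; last exact: diff_unique.
apply/diff_locallyP; rewrite (diff_unique df_cont g_eq); split=> //.
Qed.

Lemma Ck_on_sub V W k (A B : set V) (f : V -> W) :
  A `<=` B -> Ck_on k B f -> Ck_on k A f.
Proof.
move=> AB; elim: k f => [|k IH] f /=; first by move=> fB x /AB /fB.
by move=> [df dfk]; split=> [x /AB /df//|v]; apply: IH.
Qed.

(** The derivatives read values of [f] near a point of [A] only, hence the
    openness of [A]. *)
Lemma Ck_on_eq V W k (A : set V) (f g : V -> W) :
  open A -> (forall x, A x -> f x = g x) -> Ck_on k A f -> Ck_on k A g.
Proof.
move=> oA; elim: k f g => [|k IH] f g fg /=.
  move=> cf x Ax; have nfg : \near x, f x = g x.
    by apply: filterS (open_nbhs_nbhs (conj oA Ax)) => y /fg.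
  apply: (@cvg_trans _ (f @ x)); first exact: near_eq_cvg.
  by rewrite -(fg x Ax); exact: cf.
move=> [df dfk].
have nfg x : A x -> \near x, f x = g x.
  by move=> Ax; apply: filterS (open_nbhs_nbhs (conj oA Ax)) => y /fg.
split=> [x Ax|v]; first by have [] := near_eq_diff (nfg x Ax) (df x Ax).
apply: IH (dfk v) => x Ax.
by have [_ ->] := near_eq_diff (nfg x Ax) (df x Ax).
Qed.

(** [Ck_on] is a condition at each point of the set, which is what lets a map between
    manifolds be studied in a chart chosen around each point. *)
Lemma Ck_on_local V W k (A : set V) (f : V -> W) :
  (forall x, A x -> exists2 B : set V, B x & Ck_on k B f) -> Ck_on k A f.
Proof.
elim: k f => [|k IH] f locf /=.
  by move=> x /locf[B Bx]; apply.
split=> [x /locf[B Bx [df _]]|v]; first exact: df.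
by apply: IH => x /locf[B Bx [_ dfk]]; exists B => //; exact: dfk.
Qed.

Lemma Ck_on_le V W k (A : set V) (f : V -> W) : Ck_on k.+1 A f -> Ck_on k A f.
Proof.
elim: k f => [|k IH] f [df dfk] /=.
  by move=> x /df; apply: differentiable_continuous.
by split=> // v; apply: IH.
Qed.

Lemma Ck_on_continuous V W k (A : set V) (f : V -> W) :
  Ck_on k A f -> forall x, A x -> {for x, continuous f}.
Proof. by elim: k f => [//|k IH] f /Ck_on_le /IH. Qed.

Lemma Ck_on_cst V W k (A : set V) (w : W) : Ck_on k A (fun=> w).
Proof.
elim: k w => [|k IH] w /=; first by move=> x _; exact: cst_continuous.
split=> [x _|v]; first exact: differentiable_cst.
by under eq_fun do rewrite (@diff_cst _ _ _ w).
Qed.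

Lemma Ck_on_linear V W k (A : set V) (L : {linear V -> W}) :
  continuous L -> Ck_on k A L.
Proof.
move=> cL; case: k => [|k] /=; first by move=> x _; exact: cL.
split=> [x _|v]; first exact: linear_differentiable.
rewrite (_ : (fun x => _) = fun=> L v); first exact: Ck_on_cst.
by apply/funext => x; rewrite diff_lin.
Qed.

Lemma Ck_onD V W k (A : set V) (f g : V -> W) : open A ->
  Ck_on k A f -> Ck_on k A g -> Ck_on k A (f \+ g).
Proof.
move=> oA; elim: k f g => [|k IH] f g /=.
  by move=> cf cg x Ax; apply: continuousD; [exact: cf|exact: cg].
move=> [df dfk] [dg dgk]; split=> [x Ax|v].
  by apply: differentiableD; [exact: df|exact: dg].
apply: Ck_on_eq (IH _ _ (dfk v) (dgk v)) => // x Ax.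
by rewrite (diffD (df x Ax) (dg x Ax)).
Qed.

Lemma Ck_on_linear_comp U V W k (A : set V) (f : V -> W) (L : {linear W -> U}) :
  open A -> continuous L -> Ck_on k A f -> Ck_on k A (L \o f).
Proof.
move=> oA cL; elim: k f => [|k IH] f /=.
  by move=> cf x Ax; apply: continuous_comp; [exact: cf|exact: cL].
have dL y : differentiable L y by exact: linear_differentiable.
move=> [df dfk]; split=> [x Ax|v].
  by apply: differentiable_comp; [exact: df|].
apply: Ck_on_eq (IH _ (dfk v)) => // x Ax /=.
by rewrite (diff_comp (df x Ax) (dL _)) /= diff_lin.
Qed.

(** This makes scaling an instance of the differentiation rule for bilinear maps. *)
Lemma scale_is_bilinear W : bilinear_for
    (GRing.Scale.Law.clone _ _ *:%R _) (GRing.Scale.Law.clone _ _ *:%R _)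
    (@GRing.scale R W : R^o -> W -> W).
Proof.
split=> [w|h] a x y /=; first by rewrite scalerDl scalerA.
by rewrite scalerDr !scalerA mulrC.
Qed.

HB.instance Definition _ W :=
  bilinear_isBilinear.Build R R^o W W *:%R *:%R (@GRing.scale R W)
    (scale_is_bilinear W).

Lemma diff_scalef V W (h : V -> R) (g : V -> W) x :
  differentiable h x -> differentiable g x ->
  differentiable (fun y => h y *: g y) x /\
  forall v, 'd (fun y => h y *: g y) x v = h x *: 'd g x v + 'd h x v *: g x.
Proof.
move=> dh dg.
pose sc : R^o * W -> W := fun p => p.1 *: p.2.
have cs : continuous sc by move=> p; exact: scale_continuous.
have ds p : differentiable sc p by exact: differentiable_bilin.
have dp : differentiable (fun y => (h y : R^o, g y)) x by exact: differentiable_pair.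
split; first exact: (differentiable_comp dp (ds _)).
move=> v; rewrite -[LHS]/('d (sc \o (fun y => (h y : R^o, g y))) x v).
by rewrite (diff_comp dp (ds _)) /= diff_bilin//= diff_pair.
Qed.

Lemma Ck_on_scale V W k (A : set V) (h : V -> R) (g : V -> W) : open A ->
  Ck_on k A h -> Ck_on k A g -> Ck_on k A (fun y => h y *: g y).
Proof.
move=> oA; elim: k h g => [|k IH] h g /=.
  by move=> ch cg x Ax; apply: continuousZ; [exact: ch|exact: cg].
move=> hk gk; have [dh dhk] := hk; have [dg dgk] := gk; split=> [x Ax|v].
  by have [] := diff_scalef (dh x Ax) (dg x Ax).
apply: (Ck_on_eq oA _ (Ck_onD oA (IH _ _ (Ck_on_le hk) (dgk v))
   (IH _ _ (dhk v) (Ck_on_le gk)))) => x Ax.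
by have [_ ->] := diff_scalef (dh x Ax) (dg x Ax).
Qed.

Lemma Ck_on_sum V W k (A : set V) m (g : 'I_m -> V -> W) : open A ->
  (forall i, Ck_on k A (g i)) -> Ck_on k A (fun x => \sum_(i < m) g i x).
Proof.
move=> oA; elim: m g => [|m IH] g gk.
  by under eq_fun do rewrite big_ord0; exact: Ck_on_cst.
under eq_fun do rewrite big_ord_recr /=.
by apply: Ck_onD => //; exact: IH.
Qed.

Definition coordl m (i : 'I_m) (v : 'rV[R]_m) : R^o := v ord0 i.

Lemma coordl_is_linear m (i : 'I_m) : linear (@coordl m i).
Proof. by move=> a u v; rewrite /coordl !mxE. Qed.

HB.instance Definition _ m (i : 'I_m) :=
  GRing.isLinear.Build R 'rV[R]_m R^o _ (@coordl m i) (@coordl_is_linear m i).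

Lemma coordl_continuous m (i : 'I_m) : continuous (@coordl m i).
Proof. exact: coord_continuous. Qed.

(** The chain rule expresses each directional derivative of [g \o f] as a sum, over a
    basis, of coordinates of the derivative of [f] times partial derivatives of [g]
    composed with [f]; induction on [k] then applies to every term. The basis is why the
    intermediate space has finite dimension. *)
Lemma Ck_on_comp V W m k (A : set V) (B : set 'rV[R]_m)
    (f : V -> 'rV[R]_m) (g : 'rV[R]_m -> W) :
  open A -> open B -> (forall x, A x -> B (f x)) ->
  Ck_on k A f -> Ck_on k B g -> Ck_on k A (g \o f).
Proof.
move=> oA oB fAB; elim: k g => [|k IH] g fk gk.
  by move=> x Ax; apply: continuous_comp; [exact: fk|exact/gk/fAB].
have [df dfk] := fk; have [dg dgk] := gk; split=> [x Ax|v].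
  by apply: differentiable_comp; [exact: df|exact/dg/fAB].
have chain x : A x -> 'd (g \o f) x v =
    \sum_(i < m) coordl i ('d f x v) *: ('d g (f x) (delta_mx 0 i)).
  move=> Ax; rewrite (diff_comp (df x Ax) (dg _ (fAB _ Ax))) /=.
  rewrite {1}(row_sum_delta ('d f x v)) linear_sum /=.
  by apply: eq_bigr => i _; rewrite linearZ.
apply: (Ck_on_eq oA (fun x Ax => esym (chain x Ax))).
apply: Ck_on_sum => // i; apply: Ck_on_scale => //.
  exact: (Ck_on_linear_comp (L := coordl i) oA (@coordl_continuous m i) (dfk v)).
by apply: (IH (fun y => 'd g y (delta_mx 0 i))); [exact: Ck_on_le|exact: dgk].
Qed.

End Calculus.

(** * Symmetry of second derivatives *)

Section Schwarz.
Context {R : realType}.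
Implicit Types V W : normedModType R.

Lemma is_derive_line V (f : V -> R) y a (t : R) :
  differentiable f (y + t *: a) ->
  is_derive t 1 (fun s : R => f (y + s *: a)) ('d f (y + t *: a) a).
Proof.
move=> df; pose l (s : R) : V := y + s *: a.
have dl : is_diff t l (fun s : R => s *: a).
  by apply: is_diff_eq; rewrite add0r.
have dfl : differentiable (f \o l) t by apply: differentiable_comp.
apply: DeriveDef; first by apply/derivable1_diffP.
rewrite -derive1E derive1E' // -[LHS]/('d (f \o l) t 1).
rewrite (diff_comp (@ex_diff _ _ _ _ _ _ _ dl) df) /=.
by rewrite diff_val scale1r.
Qed.

Lemma mvt_line V (f : V -> R) y a (h : R) : 0 < h ->
  (forall x, differentiable f x) ->
  exists2 t, 0 <= t <= h & f (y + h *: a) - f y = h * 'd f (y + t *: a) a.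
Proof.
move=> h0 df.
have der t := is_derive_line (df (y + t *: a)).
have cont : {within `[0, h], continuous (fun s : R => f (y + s *: a))}.
  apply: derivable_within_continuous => x _.
  exact: (@ex_derive _ _ _ _ _ _ _ (der x)).
have [t] := @MVT R (fun s => f (y + s *: a)) (fun t => 'd f (y + t *: a) a)
  0 h h0 (fun x _ => der x) cont.
rewrite in_itv /= => /andP[t0 th] /=.
rewrite scale0r addr0 subr0 => eqf; exists t; first by rewrite !ltW.
by rewrite eqf mulrC.
Qed.

(** The mean value theorem is applied first along [a] to the increment of [f] in the
    direction [b], and then along [b] to the derivative of [f] along [a]. *)
Lemma second_difference V (f : V -> R) x a b (h : R) : 0 < h ->
  Ck_on 2 [set: V] f ->
  exists s t, [/\ 0 <= s <= h, 0 <= t <= h &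
    f (x + h *: a + h *: b) - f (x + h *: a) - (f (x + h *: b) - f x) =
    h * (h * 'd (fun y => 'd f y a) (x + s *: a + t *: b) b)].
Proof.
move=> h0 [/= df ddf].
have df' y : differentiable f y by exact: df.
pose u y := f (y + h *: b) - f y.
have du y : differentiable u y /\
    ('d u y : V -> R) = (fun v => 'd f (y + h *: b) v - 'd f y v).
  have dfs : is_diff y (f \o shift (h *: b)) ('d f (y + h *: b)).
    have ds : is_diff y (shift (h *: b)) id.
      by apply: is_diff_eq; rewrite addr0.
    have dfy := differentiableP (df' (shift (h *: b) y)).
    by apply: is_diff_eq.
  have dfy := differentiableP (df' y).
  have dd : is_diff y (f \o shift (h *: b) - f)
      (('d f (y + h *: b) : V -> R) - ('d f y : V -> R)).
    by apply: is_diff_eq.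
  by split; [exact: (@ex_diff _ _ _ _ _ _ _ dd)|exact: (@diff_val _ _ _ _ _ _ _ dd)].
have [s s01 us] := @mvt_line V u x a h h0 (fun y => (du y).1).
have [t t01 ut] := @mvt_line V (fun y => 'd f y a) (x + s *: a) b h h0
  (fun y => (ddf a).1 y I).
exists s, t; split=> //.
by rewrite -[LHS]/(u (x + h *: a) - u x) us (du _).2 ut.
Qed.

(** The second difference is symmetric in [a] and [b], so the two mixed derivatives agree
    at some points of any neighbourhood of [x]; both are continuous at [x]. *)
Lemma schwarz V (f : V -> R) x a b : Ck_on 2 [set: V] f ->
  'd (fun y => 'd f y a) x b = 'd (fun y => 'd f y b) x a.
Proof.
move=> f2.
have cont a' b' : {for x, continuous (fun y => 'd (fun y => 'd f y a') y b')}.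
  by have [_ /(_ a')[_ /(_ b')]] := f2; apply.
pose A y := 'd (fun y => 'd f y a) y b; pose B y := 'd (fun y => 'd f y b) y a.
rewrite -[LHS]/(A x) -[RHS]/(B x).
apply/eqP; rewrite -subr_eq0 -normr_le0; apply/ler_addgt0Pl => e e0; rewrite addr0.
have e20 : 0 < e / 2 by rewrite divr_gt0.
have nearAB : \forall y \near x, `|A x - A y| < e / 2 /\ `|B x - B y| < e / 2.
  have /cvgrPdist_lt/(_ _ e20) cA := cont a b.
  have /cvgrPdist_lt/(_ _ e20) cB := cont b a.
  by near=> y; split; near: y.
move/nbhs_ballP : nearAB => [_ /posnumP[r] ballAB].
(* a step so small that the intermediate points stay in the ball *)
pose M := `|a| + `|b| + 1.
have M0 : 0 < M by rewrite ltr_wpDl // addr_ge0.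
pose h := r%:num / 2 / M.
have h0 : 0 < h by rewrite !divr_gt0.
have inball s t : 0 <= s <= h -> 0 <= t <= h -> forall c d,
    `|c| + `|d| < M -> ball x r%:num (x + s *: c + t *: d).
  move=> /andP[s0 sh] /andP[t0 th] c d cd.
  rewrite -ball_normE /ball_ /= opprD addrA opprD addrA subrr add0r -opprD normrN.
  apply: (le_lt_trans (ler_normD _ _)); rewrite !normrZ !ger0_norm//.
  apply: (@le_lt_trans _ _ (h * (`|c| + `|d|))).
    by rewrite mulrDr lerD// ler_wpM2r.
  apply: (@lt_le_trans _ _ (h * M)); first by rewrite ltr_pM2l.
  by rewrite divfK ?gt_eqF// ler_pdivrMr// ler_pMr// ler1n.
have [s [t [s01 t01 Dab]]] := second_difference x a b h0 f2.
have [s' [t' [s01' t01' Dba]]] := second_difference x b a h0 f2.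
have eqAB : A (x + s *: a + t *: b) = B (x + s' *: b + t' *: a).
  have hn0 : h != 0 by rewrite gt_eqF.
  apply/(mulfI hn0)/(mulfI hn0); rewrite -Dab -Dba.
  by rewrite (addrAC x (h *: a)); ring.
have lt1 : `|a| + `|b| < M by rewrite ltrDl.
have lt2 : `|b| + `|a| < M by rewrite addrC.
have [Aab _] := ballAB _ (inball _ _ s01 t01 _ _ lt1).
have [_ Bba] := ballAB _ (inball _ _ s01' t01' _ _ lt2).
rewrite eqAB in Aab.
set c := B (_ + _ + _) in Aab Bba.
rewrite (_ : A x - B x = (A x - c) - (B x - c)); last by ring.
rewrite (splitr e); apply: (le_trans (ler_normB _ _)).
by rewrite lerD// ltW.
Unshelve. all: by end_near. Qed.

End Schwarz.

(** * Charts, products of atlases and composition of C^k maps *)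

Section Atlas.
Context {R : realType}.

Lemma rV_linear_continuous m (W : normedModType R) (L : {linear 'rV[R]_m -> W}) :
  continuous (L : 'rV[R]_m -> W).
Proof.
have -> : (L : _ -> _) = fun v => \sum_(i < m) coordl i v *: L (delta_mx 0 i).
  apply/funext => v; rewrite {1}(row_sum_delta v) linear_sum /=.
  by apply: eq_bigr => i _; rewrite linearZ.
move=> v; apply: (@Ck_on_continuous _ _ _ 0 setT) => //.
apply: (Ck_on_sum openT) => i; apply: (Ck_on_scale openT); last exact: Ck_on_cst.
exact: Ck_on_linear (@coordl_continuous _ m i).
Qed.

(** [row_mx] is a sum of two linear maps, so the rules for sums and linear maps apply. *)
Local Definition inl_mx m1 m2 : {linear 'rV[R]_m1 -> 'rV[R]_(m1 + m2)} :=
  mulmxr (row_mx 1%:M 0).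
Local Definition inr_mx m1 m2 : {linear 'rV[R]_m2 -> 'rV[R]_(m1 + m2)} :=
  mulmxr (row_mx 0 1%:M).

Local Lemma row_mxE m1 m2 (u : 'rV[R]_m1) (v : 'rV[R]_m2) :
  row_mx u v = inl_mx m1 m2 u + inr_mx m1 m2 v.
Proof.
rewrite /inl_mx /inr_mx /= !mul_mx_row !mulmx1 !mulmx0.
by rewrite add_row_mx addr0 add0r.
Qed.

Lemma cvg_row_mx m1 m2 (T : Type) (F : set_system T) (f : T -> 'rV[R]_m1)
    (g : T -> 'rV[R]_m2) (u : 'rV[R]_m1) (v : 'rV[R]_m2) : Filter F ->
  f @ F --> u -> g @ F --> v -> row_mx (f x) (g x) @[x --> F] --> row_mx u v.
Proof.
move=> FF fu gv; rewrite row_mxE; under eq_fun do rewrite row_mxE.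
have Hl := cvg_comp _ _ fu (@rV_linear_continuous _ _ (inl_mx m1 m2) u).
have Hr := cvg_comp _ _ gv (@rV_linear_continuous _ _ (inr_mx m1 m2) v).
have H := cvgD Hl Hr.
exact: H.
Qed.

Lemma Ck_on_row_mx (V : normedModType R) m1 m2 k (A : set V)
    (f : V -> 'rV[R]_m1) (g : V -> 'rV[R]_m2) : open A ->
  Ck_on k A f -> Ck_on k A g -> Ck_on k A (fun x => row_mx (f x) (g x)).
Proof.
move=> oA fk gk.
have -> : (fun x => row_mx (f x) (g x)) =
    (inl_mx m1 m2 \o f) \+ (inr_mx m1 m2 \o g).
  by apply/funext => x; exact: row_mxE.
by apply: Ck_onD => //; apply: Ck_on_linear_comp => //; exact: rV_linear_continuous.
Qed.

Lemma Ck_on_const_mx (V : normedModType R) k (A : set V) (h : V -> R) : open A ->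
  Ck_on k A h -> Ck_on k A (fun x => const_mx (h x) : 'rV[R]_1).
Proof.
move=> oA hk.
rewrite (_ : (fun x => _) = fun x => h x *: (const_mx 1 : 'rV[R]_1)).
  by apply: Ck_on_scale => //; exact: Ck_on_cst.
by apply/funext => x; apply/rowP => i; rewrite !mxE mulr1.
Qed.

Section Charts.
Variables (n : nat) (M : topologicalType).
Implicit Types (c : chart R n M) (A : set (chart R n M)).

(** The topological half of [smooth_atlas]: it passes to products of atlases without
    any differentiation, and suffices to compose and to pair C^k maps. *)
Definition chart_cover A : Prop :=
  (forall c, A c -> is_chart c) /\ (forall x, exists2 c, A c & chart_dom c x).

Lemma smooth_atlas_cover A : smooth_atlas A -> chart_cover A.
Proof. by case. Qed.

Lemma chart_dom_open c : is_chart c -> open (chart_dom c). Proof. by case. Qed.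

Lemma chart_image_open c (S : set M) :
  is_chart c -> open S -> S `<=` chart_dom c -> open (chart_fun c @` S).
Proof.
move=> [_ oI cK _ ci] oS Sc; rewrite openE => _ [x Sx <-].
have Icx : (chart_fun c @` chart_dom c) (chart_fun c x) by exists x => //; exact: Sc.
have nI : nbhs (chart_fun c x) (chart_fun c @` chart_dom c).
  exact: (open_nbhs_nbhs (conj oI Icx)).
have nS : nbhs (chart_fun c x) (chart_inv c @^-1` S).
  by apply: (ci _ Icx); rewrite (cK _ (Sc _ Sx)); exact: (open_nbhs_nbhs (conj oS Sx)).
apply: filterS2 nI nS => _ [y cy <-] /=; rewrite cK// => Sy.
by exists y.
Qed.

Lemma chart_dom_preim_open (N : topologicalType) c (f : M -> N) (D : set N) :
  is_chart c -> continuous f -> open D ->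
  open (chart_fun c @` (chart_dom c `&` f @^-1` D)).
Proof.
move=> cc cf oD; apply: chart_image_open => //.
by apply: openI; [exact: chart_dom_open|apply: open_comp => // ? _; exact: cf].
Qed.

Lemma near_chart c x : is_chart c -> chart_dom c x -> nbhs x (chart_dom c).
Proof. by move=> [oc _ _ _ _] cx; exact: (open_nbhs_nbhs (conj oc cx)). Qed.

End Charts.

Section Maps.
Variables (n m p : nat) (M N P : topologicalType).
Variables (A : set (chart R n M)) (B : set (chart R m N)) (C : set (chart R p P)).
Hypotheses (hA : chart_cover A) (hB : chart_cover B) (hC : chart_cover C).

(** Near each point, the coordinate expression of the composite factors through a chart
    of the intermediate manifold around the image of that point. *)
Lemma Ck_map_comp k (f : M -> N) (g : N -> P) :
  Ck_map k A B f -> Ck_map k B C g -> Ck_map k A C (g \o f).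
Proof.
move=> [cf fk] [cg gk]; split.
  by move=> x; exact: (continuous_comp (cf x) (cg _)).
move=> c e Ac Ce; apply: Ck_on_local => _ [x [cx ex] <-].
have [d Bd dx] := hB.2 (f x).
have cc := hA.1 _ Ac; have dd := hB.1 _ Bd; have oe := chart_dom_open (hC.1 _ Ce).
have [_ _ cK _ _] := cc; have [_ _ dK _ _] := dd.
pose D := chart_dom d `&` g @^-1` chart_dom e.
have oD : open D.
  by apply: openI; [exact: chart_dom_open|apply: open_comp => // ? _; exact: cg].
pose O := chart_fun c @` (chart_dom c `&` f @^-1` D).
have oO : open O by exact: chart_dom_preim_open.
exists O; first by exists x.
apply: (@Ck_on_eq _ _ _ _ _
  ((chart_fun e \o g \o chart_inv d) \o (chart_fun d \o f \o chart_inv c))) => //.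
  by move=> _ [y [cy [dy _]] <-] /=; rewrite cK// dK.
apply: (Ck_on_comp oO (chart_dom_preim_open dd cg oe)).
- by move=> _ [y [cy [dy ey]] <-] /=; rewrite cK//; exists (f y).
- by apply: Ck_on_sub (fk c d Ac Bd) => _ [y [cy [dy _]] <-]; exists y.
- exact: gk.
Qed.

Lemma Ck_map_cst k (y : N) : Ck_map k A B (fun=> y).
Proof.
split=> [x|c d Ac Bd]; first exact: cst_continuous.
exact: (Ck_on_cst _ _ (chart_fun d y)).
Qed.

Lemma Ck_map_pair k (f : M -> N) (g : M -> P) :
  Ck_map k A B f -> Ck_map k A C g ->
  Ck_map k A (prod_atlas B C) (fun x => (f x, g x)).
Proof.
move=> [cf fk] [cg gk]; split.
  by move=> x; apply: cvg_pair; [exact: cf|exact: cg].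
move=> c _ Ac [d Bd [e Ce <-]].
have cc := hA.1 _ Ac; have od := chart_dom_open (hB.1 _ Bd).
have oe := chart_dom_open (hC.1 _ Ce).
apply: Ck_on_row_mx.
- apply: chart_image_open => //.
  apply: openI; first exact: chart_dom_open.
  rewrite (_ : _ @^-1` _ = f @^-1` chart_dom d `&` g @^-1` chart_dom e) //.
  apply: openI; first exact: open_comp (fun x _ => cf x) od.
  exact: open_comp (fun x _ => cg x) oe.
- by apply: Ck_on_sub (fk c d Ac Bd) => _ [y [cy [dy ey]] <-]; exists y.
- by apply: Ck_on_sub (gk c e Ac Ce) => _ [y [cy [dy ey]] <-]; exists y.
Qed.

Lemma prod_atlas_cover : chart_cover (prod_atlas A B).
Proof.
split=> [_ [c Ac [d Bd <-]]|[x y]]; last first.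
  have [c Ac cx] := hA.2 x; have [d Bd dy] := hB.2 y.
  by exists (prod_chart c d) => //; exists c => //; exists d.
have [oc ocI cK cc ci] := hA.1 _ Ac; have [od odI dK cd di] := hB.1 _ Bd.
have imE : chart_fun (prod_chart c d) @` chart_dom (prod_chart c d) =
    lsubmx @^-1` (chart_fun c @` chart_dom c) `&`
    rsubmx @^-1` (chart_fun d @` chart_dom d).
  apply/seteqP; split=> [_ [[x y] /= [cx dy] <-]|v [[x cx xv] [y dy yv]]] /=.
    by rewrite row_mxKl row_mxKr; split; [exists x|exists y].
  by exists (x, y) => //=; rewrite xv yv hsubmxK.
split.
- rewrite openE => -[x y] /= [cx dy].
  exists (chart_dom c, chart_dom d); last by [].
  by split; [exact: (open_nbhs_nbhs (conj oc cx))|exact: (open_nbhs_nbhs (conj od dy))].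
- rewrite imE; apply: openI; apply: open_comp => // v _.
    exact: continuous_lsubmx.
  exact: continuous_rsubmx.
- by move=> [x y] /= [cx dy]; rewrite row_mxKl row_mxKr cK// dK.
- move=> [x y] /= [cx dy]; apply: cvg_row_mx.
    exact: (@continuous_comp _ _ _ fst (chart_fun c) (x, y) cvg_fst (cc _ cx)).
  exact: (@continuous_comp _ _ _ snd (chart_fun d) (x, y) cvg_snd (cd _ dy)).
- move=> v; rewrite imE => -[vl vr].
  have Hl := @continuous_comp _ _ _ lsubmx (chart_inv c) v
    (@continuous_lsubmx _ _ _ _ v) (ci _ vl).
  have Hr := @continuous_comp _ _ _ rsubmx (chart_inv d) v
    (@continuous_rsubmx _ _ _ _ v) (di _ vr).
  exact: (cvg_pair Hl Hr).
Qed.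

End Maps.
End Atlas.

(** * Coordinate maps, scalar functions and partial derivatives *)

Section Functions.
Context {R : realType}.

Notation line := (@line_atlas R).

Lemma line_smooth_atlas : smooth_atlas line.
Proof.
split=> [_ ->|x|_ _ -> -> k] /=.
- have rangeT : [set const_mx t | t in [set: R]] = [set: 'rV[R]_1].
    apply/seteqP; split=> // v _; exists (v ord0 ord0) => //.
    by apply/rowP => i; rewrite mxE (ord1 i).
  split=> /=; first exact: openT.
  - by rewrite rangeT; exact: openT.
  - by move=> x _; rewrite mxE.
  - move=> x _; apply: (@Ck_on_const_mx R R 0 setT id openT _ x I).
    by move=> y _; exact: cvg_id.
  - by move=> v _; exact: coord_continuous.
- by exists (Chart [set: R] (fun t => const_mx t) (fun v => v ord0 ord0)).
- rewrite setTI; apply: Ck_on_sub (subsetT _) _; apply: (Ck_on_const_mx openT).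
  exact: Ck_on_linear (@coordl_continuous _ 1 ord0).
Qed.

Definition line_cover := smooth_atlas_cover line_smooth_atlas.

Section Basic.
Variables (n m : nat) (M N : topologicalType).
Variables (A : set (chart R n M)) (B : set (chart R m N)).
Hypotheses (hA : smooth_atlas A) (hB : smooth_atlas B).

Let cA := smooth_atlas_cover hA.
Let cB := smooth_atlas_cover hB.

Lemma Ck_map_id k : Ck_map k A A id.
Proof.
split=> [x|c d Ac Ad]; first exact: cvg_id.
by have [_ _ /(_ c d Ac Ad k)] := hA.
Qed.

Lemma Ck_map_fst k : Ck_map k (prod_atlas A B) A fst.
Proof.
split=> [x|_ c' [c Ac [d Bd <-]] Ac']; first exact: cvg_fst.
have cc := cA.1 _ Ac; have dd := cB.1 _ Bd; have cc' := cA.1 _ Ac'.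
have pp : is_chart (prod_chart c d).
  by apply: (prod_atlas_cover cA cB).1; exists c => //; exists d.
have oD : open (chart_fun c @` (chart_dom c `&` chart_dom c')).
  apply: chart_image_open => //; apply: openI; exact: chart_dom_open.
apply: (@Ck_on_comp _ _ _ _ _ _ _ lsubmx (chart_fun c' \o chart_inv c) _ oD).
- apply: chart_dom_preim_open => //; last exact: chart_dom_open.
  by move=> x; exact: cvg_fst.
- by move=> _ [[x y] [[cx dy] cx'] <-] /=; rewrite row_mxKl; exists x.
- by apply: Ck_on_linear; exact: continuous_lsubmx.
- by have [_ _] := hA; apply.
Qed.

Lemma Ck_map_snd k : Ck_map k (prod_atlas A B) B snd.
Proof.
split=> [x|_ d' [c Ac [d Bd <-]] Bd']; first exact: cvg_snd.
have cc := cA.1 _ Ac; have dd := cB.1 _ Bd; have dd' := cB.1 _ Bd'.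
have pp : is_chart (prod_chart c d).
  by apply: (prod_atlas_cover cA cB).1; exists c => //; exists d.
have oD : open (chart_fun d @` (chart_dom d `&` chart_dom d')).
  apply: chart_image_open => //; apply: openI; exact: chart_dom_open.
apply: (@Ck_on_comp _ _ _ _ _ _ _ rsubmx (chart_fun d' \o chart_inv d) _ oD).
- apply: chart_dom_preim_open => //; last exact: chart_dom_open.
  by move=> x; exact: cvg_snd.
- by move=> _ [[x y] [[cx dy] dy'] <-] /=; rewrite row_mxKr; exists y.
- by apply: Ck_on_linear; exact: continuous_rsubmx.
- by have [_ _] := hB; apply.
Qed.

End Basic.

Section Scalar.
Variables (n : nat) (M : topologicalType) (A : set (chart R n M)).
Hypothesis cA : chart_cover A.

(** For functions with values in the line, [Ck_map] reduces to a condition on scalar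
    functions in the charts of the source (see [Ck_map_funP]). *)
Definition Ck_fun k (f : M -> R) : Prop :=
  forall c, A c -> Ck_on k (chart_fun c @` chart_dom c) (f \o chart_inv c).

Lemma chart_range_open c : A c -> open (chart_fun c @` chart_dom c).
Proof. by move=> /cA.1[]. Qed.

Lemma Ck_fun_continuous k f : Ck_fun k f -> continuous f.
Proof.
move=> fk x; have [c Ac cx] := cA.2 x; have cc := cA.1 _ Ac.
have [_ _ cK ccont _] := cc.
have fx : {for chart_fun c x, continuous (f \o chart_inv c)}.
  by apply: (Ck_on_continuous (fk c Ac)); exists x.
have H : f (chart_inv c (chart_fun c y)) @[y --> x] -->
    f (chart_inv c (chart_fun c x)).
  exact: (@continuous_comp _ _ _ (chart_fun c) (f \o chart_inv c) x (ccont _ cx) fx).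
rewrite [in X in _ --> X](cK _ cx) in H.
apply: cvg_trans H; apply: near_eq_cvg.
by apply: filterS (near_chart cc cx) => y cy /=; rewrite cK.
Qed.

Lemma Ck_map_funP k f : Ck_map k A line f <-> Ck_fun k f.
Proof.
split=> [[_ fk] c Ac|fk].
  have /(_ (Chart [set: R] (fun t => const_mx t) (fun v => v ord0 ord0)) erefl) :=
    fk c _ Ac.
  rewrite /= setIT => {}fk.
  have := Ck_on_linear_comp (L := @coordl R 1 ord0) (chart_range_open Ac)
    (@coordl_continuous _ _ _) fk.
  by apply: Ck_on_eq; [exact: chart_range_open|move=> v _; rewrite /= /coordl mxE].
split; first exact: Ck_fun_continuous fk.
move=> c _ Ac -> /=; rewrite setIT.
by apply: Ck_on_const_mx; [exact: chart_range_open|exact: fk].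
Qed.


End Scalar.

Section Partial.
Variables (n : nat) (M : topologicalType) (A : set (chart R n M)).
Hypothesis cA : chart_cover A.

(** In a chart, the derivative in [t] at [0] is a directional derivative of the
    coordinate expression of [H], restricted to the slice t = 0. *)
Lemma Ck_fun_partial k (H : M * R -> R) : Ck_fun (prod_atlas A line) k.+1 H ->
  Ck_fun A k (fun x => derive1 (fun t => H (x, t)) 0).
Proof.
move=> Hk.
pose l : chart R 1 R := Chart [set: R] (fun t => const_mx t) (fun v => v ord0 ord0).
pose e : 'rV[R]_(n + 1) := row_mx 0 (const_mx 1).
pose P (c : chart R n M) := H \o chart_inv (prod_chart c l).
have Apl c : A c -> prod_atlas A line (prod_chart c l).
  by move=> Ac; exists c => //; exists l.
have Pin (c : chart R n M) x : chart_dom c x ->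
    (chart_fun (prod_chart c l) @` chart_dom (prod_chart c l))
      (row_mx (chart_fun c x) 0).
  by move=> cx; exists (x, 0).
have der c x : A c -> chart_dom c x ->
    is_derive (0 : R) 1 (fun t : R => H (x, t)) ('d (P c) (row_mx (chart_fun c x) 0) e).
  move=> Ac cx; have [_ _ cK _ _] := cA.1 _ Ac.
  have -> : (fun t => H (x, t)) =
      fun t => P c (row_mx (chart_fun c x) 0 + t *: e).
    apply/funext => t; rewrite /P /= linearD linearZ /= /e !row_mxKl scaler0 addr0 cK//.
    by rewrite linearD linearZ /= !row_mxKr !mxE add0r mulr1.
  have -> : row_mx (chart_fun c x) 0 = row_mx (chart_fun c x) 0 + (0 : R) *: e.
    by rewrite scale0r addr0.
  rewrite [in X in is_derive _ _ X _]scale0r [in X in is_derive _ _ X _]addr0.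
  apply: is_derive_line; rewrite scale0r addr0.
  by have [+ _] := Hk _ (Apl _ Ac); apply; exact: Pin.
move=> c Ac; have [_ _ cK _ _] := cA.1 _ Ac.
have oc := chart_range_open cA Ac.
have [_ /(_ e) Pk] := Hk _ (Apl _ Ac).
have opl := chart_range_open (prod_atlas_cover cA line_cover) (Apl _ Ac).
have embk : Ck_on k (chart_fun c @` chart_dom c)
    (fun v : 'rV[R]_n => row_mx v (0 : 'rV[R]_1)).
  apply: Ck_on_row_mx => //; last exact: Ck_on_cst.
  by apply: (@Ck_on_linear _ _ _ _ _ idfun) => v; exact: cvg_id.
apply: (Ck_on_eq oc _ (Ck_on_comp oc opl _ embk Pk)).
  move=> _ [x cx <-] /=; rewrite cK// derive1E.
  by rewrite (@derive_val _ _ _ _ _ _ _ (der c x Ac cx)).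
by move=> _ [x cx <-]; exact: Pin.
Qed.

End Partial.
End Functions.

(** * Dual bases of finite-dimensional function spaces; the sine function *)

Section LinearAlgebra.
Variable R : realType.

(** Finitely many evaluations already determine a vector of a finite-dimensional space of
    functions on [S]. The points [u] are chosen so that the matrix of the evaluations at
    them has maximal rank; evaluation at any other point then lies in its row space, and
    a partial inverse of the matrix provides the vectors [e]. *)
Lemma dual_basis d (S : Type) (L : S -> {linear 'rV[R]_d -> R^o}) :
  exists k (u : 'I_k -> S) (e : 'I_k -> 'rV[R]_d), forall v s,
    L s v = \sum_(i < k) L (u i) v * L s (e i).
Proof.
pose row_of s : 'rV[R]_d := \row_j L s (delta_mx 0 j).
have rowE s v : L s v = (row_of s *m v^T) 0 0.
  rewrite {1}(row_sum_delta v) linear_sum mxE; apply: eq_bigr => j _.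
  by rewrite linearZ !mxE [LHS]mulrC.
pose mat k (u : 'I_k -> S) : 'M[R]_(k, d) := \matrix_i row_of (u i).
pose attained r := `[< exists k (u : 'I_k -> S), \rank (mat k u) = r >].
have exr : exists r, attained r.
  have u0 : 'I_0 -> S by case.
  exists 0; apply/asboolP; exists 0, u0.
  by apply/eqP; rewrite -leqn0 rank_leq_row.
have bound r : attained r -> (r <= d)%N.
  by move=> /asboolP[k [u <-]]; exact: rank_leq_col.
have [r /asboolP[k [u rk]] rmax] := ex_maxnP exr bound.
have inspan s : (row_of s <= mat k u)%MS.
  pose u' (i : 'I_(1 + k)) := match fintype.split i with inl _ => s | inr j => u j end.
  have matE : mat (1 + k)%N u' = col_mx (row_of s) (mat k u).
    apply/row_matrixP => i; rewrite rowK /u'.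
    case: split_ordP => j ->; first by rewrite rowKu row_id.
    by rewrite rowKd rowK.
  have rk' : (\rank (mat (1 + k)%N u') <= r)%N.
    by apply: rmax; apply/asboolP; exists (1 + k)%N, u'.
  rewrite matE in rk'.
  have sub2 : (mat k u <= col_mx (row_of s) (mat k u))%MS.
    by rewrite -addsmxE addsmxSr.
  have := mxrank_leqif_eq sub2 => -[_]; rewrite rk.
  have -> : r == \rank (col_mx (row_of s) (mat k u)).
    by rewrite eqn_leq rk' -rk mxrankS.
  move=> /esym/eqmxP eqs; rewrite eqs -addsmxE; exact: addsmxSl.
pose B := pinvmx (mat k u).
exists k, u, (fun i => (col i B)^T) => v s.
rewrite rowE -{1}(mulmxKpV (inspan s)) -(mulmxA (row_of s *m _)) mxE.
apply: eq_bigr => i _; rewrite !rowE trmxK mulrC; congr (_ * _).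
  rewrite !mxE; apply: eq_bigr => j _; by rewrite !mxE.
by rewrite !mxE; apply: eq_bigr => j _; rewrite !mxE.
Qed.

End LinearAlgebra.

Section Sine.
Context {R : realType}.

Lemma Ck_on_sin_cos (V : normedModType R) k (A : set V) (L : {linear V -> R^o}) :
  open A -> continuous (L : V -> R) ->
  Ck_on k A (fun v => sin (L v)) /\ Ck_on k A (fun v => cos (L v)).
Proof.
move=> oA cL.
have dL (x : V) : differentiable (L : V -> R^o) x by exact: linear_differentiable.
have dsin (x : R) : differentiable (sin : R -> R) x by exact/derivable1_diffP.
have dcos (x : R) : differentiable (cos : R -> R) x by exact/derivable1_diffP.
have Lk j : Ck_on j A (L : V -> R^o) by exact: Ck_on_linear.
elim: k => [|k [IHs IHc]].
  split=> x _; apply: continuous_comp => //; first exact: cL.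
  - exact: continuous_sin.
  - exact: cL.
  - exact: continuous_cos.
split; split=> [x Ax|v].
- exact: (differentiable_comp (dL x) (dsin _)).
- have := Ck_on_scale oA IHc (Ck_on_cst k A (L v : R)).
  apply: Ck_on_eq => // x Ax.
  rewrite -[RHS]/('d ((sin : R -> R) \o L) x v) (diff_comp (dL x) (dsin _)) /=.
  by rewrite diff_lin// deriv1E//= derive1E derive_val [RHS]mulrC.
- exact: (differentiable_comp (dL x) (dcos _)).
- have := Ck_on_scale oA IHs (Ck_on_cst k A (- L v : R)).
  apply: Ck_on_eq => // x Ax.
  rewrite -[RHS]/('d ((cos : R -> R) \o L) x v) (diff_comp (dL x) (dcos _)) /=.
  rewrite diff_lin// deriv1E//= derive1E derive_val.
  by rewrite [RHS]mulrC mulNr -mulrN.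
Qed.

End Sine.

(** * Tangent spaces *)

Lemma is_derive_derive1 (R : realType) (f : R -> R) (x d : R) :
  is_derive x 1 f d -> derive1 f x = d.
Proof. by move=> fd; rewrite derive1E derive_val. Qed.

Section Tangent.
Context {R : realType}.
Variables (n : nat) (M : topologicalType) (A : set (chart R n M)).
Hypothesis hA : smooth_atlas A.

Notation line := (@line_atlas R).
Let cA := smooth_atlas_cover hA.
Let cL := @line_cover R.
Let l : chart R 1 R := Chart [set: R] (fun t => const_mx t) (fun v => v ord0 ord0).
Let line_l : line l. Proof. by []. Qed.

Lemma smooth_mapP (f : M -> R) : smooth_map A line f <-> forall k, Ck_fun A k f.
Proof. by split=> fk k; apply/(Ck_map_funP cA). Qed.

Lemma smooth_Ck_fun k (f : M -> R) : smooth_map A line f -> Ck_fun A k f.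
Proof. by move=> /smooth_mapP. Qed.

Lemma velocity_smooth (gamma : R -> M) f : smooth_map A line f ->
  velocity A gamma f = derive1 (f \o gamma : R -> R^o) 0.
Proof. by rewrite /velocity => sf; rewrite asboolT. Qed.

(** The inverse of the coordinate isomorphism that the chart [c] induces on the tangent
    space at [p]. *)
Definition coord_tangent (c : chart R n M) (p : M) (v : 'rV[R]_n) : functional R M :=
  fun f => if `[< smooth_map A line f >]
           then 'd (f \o chart_inv c) (chart_fun c p) v else 0.

Lemma coord_tangent_linear c p a u v :
  coord_tangent c p (a *: u + v) = a *: coord_tangent c p u + coord_tangent c p v.
Proof.
apply/funext => f; rewrite /coord_tangent !fctE.
by case: ifP => _; rewrite ?linearP// scaler0 addr0.
Qed.

Lemma smooth_chart_differentiable c p f : A c -> chart_dom c p ->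
  smooth_map A line f -> differentiable (f \o chart_inv c) (chart_fun c p).
Proof.
move=> Ac cp /(smooth_Ck_fun 1)/(_ c Ac)[+ _]; apply; by exists p.
Qed.

(** The chain rule in the chart [c]: the coordinates are the derivative of the curve
    read in [c]. *)
Lemma velocity_coord c (gamma : R -> M) : A c -> chart_dom c (gamma 0) ->
  Ck_map 1 line A gamma -> exists v, velocity A gamma = coord_tangent c (gamma 0) v.
Proof.
move=> Ac c0 hgamma; have [gcont gk] := hgamma.
have cc := cA.1 _ Ac; have [_ _ cK _ _] := cc.
pose e : 'rV[R]_1 := const_mx 1.
have l0 : chart_fun l 0 = 0 by apply/rowP => i; rewrite !mxE.
pose U := chart_fun l @` (chart_dom l `&` gamma @^-1` chart_dom c).
have oU : open U.
  exact: (chart_dom_preim_open (cL.1 _ line_l) gcont (chart_dom_open cc)).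
have U0 : U 0 by rewrite -l0; exists 0.
pose g := chart_fun c \o gamma \o chart_inv l.
have dg : differentiable g 0 by have [+ _] := gk l c line_l Ac; apply.
have g0 : g 0 = chart_fun c (gamma 0) by rewrite /g /= mxE.
exists ('d g 0 e); apply/funext => f; rewrite /coord_tangent.
case: ifPn => [/asboolP sf|]; last by rewrite /velocity => /negbTE->.
rewrite velocity_smooth//.
have dfc := smooth_chart_differentiable Ac c0 sf.
pose h := f \o gamma \o chart_inv l.
have eqh : \forall y \near (0 : 'rV[R]_1), ((f \o chart_inv c) \o g) y = h y.
  apply: filterS (open_nbhs_nbhs (conj oU U0)) => _ [t [_ ct] <-].
  by rewrite /h /g /= !mxE cK.
have dfg : differentiable ((f \o chart_inv c) \o g) 0.
  by apply: differentiable_comp => //; rewrite g0.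
have [dh dhE] := near_eq_diff eqh dfg.
have der : is_derive (0 : R) 1 (fun t : R => h (0 + t *: e))
    ('d h (0 + (0 : R) *: e) e).
  by apply: is_derive_line; rewrite scale0r addr0.
rewrite scale0r addr0 in der.
have -> : (f \o gamma : R -> R^o) = fun t : R => h (0 + t *: e).
  by apply/funext => t; rewrite /h /= !mxE add0r mulr1.
transitivity ('d h 0 e); first exact: is_derive_derive1 der.
rewrite dhE.
rewrite -g0 in dfc *.
by rewrite (diff_comp dg dfc).
Qed.

(** The straight line of direction [v] may leave the chart, so it is reparametrised by
    t |-> sin (N t) / N, which is smooth, tangent to the identity at [0] and bounded by
    1 / N. *)
Lemma smooth_curve_exists c p v : A c -> chart_dom c p ->
  exists gamma : R -> M, [/\ smooth_map line A gamma, gamma 0 = p &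
    velocity A gamma = coord_tangent c p v].
Proof.
move=> Ac cp; have cc := cA.1 _ Ac; have [oc oI cK ccont cinv] := cc.
have Icp : (chart_fun c @` chart_dom c) (chart_fun c p) by exists p.
have /nbhs_ballP[_ /posnumP[r] ballc] := open_nbhs_nbhs (conj oI Icp).
pose N := `|v| / r%:num + 1.
have N0 : 0 < N by rewrite ltr_wpDl.
pose w := N^-1 *: v.
have wr : `|w| < r%:num.
  rewrite normrZ gtr0_norm ?invr_gt0// ltr_pdivrMl// mulrDl mul1r divfK//.
  by rewrite ltrDl.
pose L : {linear 'rV[R]_1 -> R^o} := N \*: @coordl R 1 ord0.
have cLL : continuous (L : 'rV[R]_1 -> R) := @rV_linear_continuous R 1 R^o L.
pose gh (t : R) : 'rV[R]_n := chart_fun c p + sin (N * t) *: w.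
have ghI t : (chart_fun c @` chart_dom c) (gh t).
  apply: ballc; rewrite -ball_normE /ball_ /= opprD addNKr normrN normrZ.
  apply: le_lt_trans wr; rewrite -[leRHS]mul1r ler_wpM2r// sin_max//.
have ghk k : Ck_on k [set: 'rV[R]_1] (gh \o chart_inv l).
  have := Ck_onD openT (Ck_on_cst k _ (chart_fun c p))
    (Ck_on_scale openT (Ck_on_sin_cos k (L := L) openT cLL).1 (Ck_on_cst k _ w)).
  exact.
have ghcont : continuous gh.
  move=> t; have csin : {for t, continuous (fun t : R => sin (N * t))}.
    apply: (@continuous_comp _ _ _ ( *%R N) sin); first exact: mulrl_continuous.
    exact: continuous_sin.
  have := cvgD (cvg_cst (chart_fun c p)) (@cvgZr_tmp _ _ _ _ _ _ _ w csin).
  exact.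
pose gamma t := chart_inv c (gh t).
have gcont : continuous gamma.
  move=> t; apply: (@continuous_comp _ _ _ gh (chart_inv c)); first exact: ghcont.
  exact: cinv.
have sgamma : smooth_map line A gamma.
  move=> k; split=> // _ d -> Ad; have dd := cA.1 _ Ad.
  have oU := chart_dom_preim_open (cL.1 _ line_l) gcont (chart_dom_open dd).
  have oB : open (chart_fun c @` (chart_dom c `&` chart_dom d)).
    apply: chart_image_open => //; apply: openI; exact: chart_dom_open.
  apply: (@Ck_on_comp _ _ _ _ _ _ _ (gh \o chart_inv l)
    (chart_fun d \o chart_inv c) oU oB).
  - move=> _ [t [_ dt] <-] /=; rewrite mxE; have [q cq qt] := ghI t.
    by exists q => //; split=> //; move: dt; rewrite /= /gamma -qt cK.
  - exact: Ck_on_sub (subsetT _) (ghk k).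
  - by have [_ _] := hA; apply.
have gh0 : gh 0 = chart_fun c p by rewrite /gh mulr0 sin0 scale0r addr0.
have gamma0 : gamma 0 = p by rewrite /gamma gh0 cK.
exists gamma; split=> //; apply/funext => f; rewrite /coord_tangent.
case: ifPn => [/asboolP sf|]; last by rewrite /velocity => /negbTE->.
rewrite velocity_smooth//.
have dfc := smooth_chart_differentiable Ac cp sf.
have dsinN : is_derive (0 : R) 1 (fun t : R => sin (N * t)) N.
  have dN : is_derive (0 : R) 1 ( *%R N) N.
    by apply: is_derive_eq; rewrite [LHS]mulr1.
  apply: is_derive_eq (@is_derive1_comp R sin ( *%R N) 0 _ _ (is_derive_sin _) dN) _.
  by rewrite mulr0 cos0 mul1r.
pose psi (s : R) := (f \o chart_inv c) (chart_fun c p + s *: w).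
have dpsi : is_derive (sin (N * 0)) 1 psi ('d (f \o chart_inv c) (chart_fun c p) w).
  rewrite mulr0 sin0.
  have := @is_derive_line R _ (f \o chart_inv c) (chart_fun c p) w 0.
  by rewrite scale0r addr0; apply.
have := @is_derive1_comp R psi (fun t => sin (N * t)) 0 _ _ dpsi dsinN.
move=> /is_derive_derive1.
rewrite -[X in X = _]/(derive1 (f \o gamma : R -> R^o) 0) => ->.
by rewrite /w linearZ /= [LHS]mulrC [LHS]mulVKf// gt_eqF.
Qed.

Lemma tangent_spaceP c p : A c -> chart_dom c p -> forall Z,
  tangent_space A p Z <-> exists v, Z = coord_tangent c p v.
Proof.
move=> Ac cp Z; split=> [[gamma [gk g0] <-]|[v ->]].
  by have := @velocity_coord c gamma Ac; rewrite g0; apply.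
have [gamma [sg g0 <-]] := smooth_curve_exists v Ac cp.
by exists gamma => //; split=> //; exact: sg.
Qed.

Lemma tangent_space_linear p a Z1 Z2 :
  tangent_space A p Z1 -> tangent_space A p Z2 -> tangent_space A p (a *: Z1 + Z2).
Proof.
have [c Ac cp] := cA.2 p.
move=> /(tangent_spaceP Ac cp)[v1 ->] /(tangent_spaceP Ac cp)[v2 ->].
by apply/(tangent_spaceP Ac cp); exists (a *: v1 + v2); rewrite coord_tangent_linear.
Qed.

Lemma tangent_smooth_curve p Z : tangent_space A p Z ->
  exists gamma : R -> M,
    [/\ smooth_map line A gamma, gamma 0 = p & Z = velocity A gamma].
Proof.
have [c Ac cp] := cA.2 p; move=> /(tangent_spaceP Ac cp)[v ->].
have [gamma [sg g0 gv]] := smooth_curve_exists v Ac cp.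
by exists gamma; split.
Qed.

(** This reduces statements about tangent-vector-valued functions to finitely many real
    functions, namely the values on the test functions [u]. *)
Lemma tangent_space_basis p :
  exists k (u : 'I_k -> M -> R) (e : 'I_k -> functional R M),
    (forall i, tangent_space A p (e i)) /\
    forall Z, tangent_space A p Z -> Z = \sum_(i < k) Z (u i) *: e i.
Proof.
have [c Ac cp] := cA.2 p.
have lin (f : M -> R) : linear (fun v => coord_tangent c p v f : R^o).
  by move=> a u v; rewrite coord_tangent_linear.
pose L f : {linear 'rV[R]_n -> R^o} :=
  HB.pack (fun v => coord_tangent c p v f : R^o)
    (GRing.isLinear.Build _ _ _ _ _ (lin f)).
have [k [u [e Lue]]] := dual_basis L.
exists k, u, (fun i => coord_tangent c p (e i)); split.
  by move=> i; apply/(tangent_spaceP Ac cp); exists (e i).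
move=> Z /(tangent_spaceP Ac cp)[v ->]; apply/funext => f.
by rewrite fct_sumE; exact: (Lue v f).
Qed.

End Tangent.

(** * Lie groups: adjoint action, centre and the derivative of a cocycle *)

Section MixedDerivatives.
Context {R : realType}.
Notation line := (@line_atlas R).

(** The form of [schwarz] met in Lie brackets: both iterated derivatives are mixed second
    derivatives of [K] read in the plane. *)
Lemma derive1_swap (K : R * R -> R) : Ck_fun (prod_atlas line line) 2 K ->
  derive1 (fun s => derive1 (fun t => K (s, t)) 0) 0 =
  derive1 (fun t => derive1 (fun s => K (s, t)) 0) 0.
Proof.
move=> K2.
pose l : chart R 1 R := Chart [set: R] (fun t => const_mx t) (fun v => v ord0 ord0).
pose P := K \o chart_inv (prod_chart l l).
have P2 : Ck_on 2 [set: 'rV[R]_(1 + 1)] P.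
  have /K2 : prod_atlas line line (prod_chart l l) by exists l => //; exists l.
  apply: Ck_on_sub => v _; exists (lsubmx v ord0 ord0, rsubmx v ord0 ord0) => //=.
  by rewrite -[RHS]hsubmxK; congr row_mx; apply/rowP => i; rewrite !mxE (ord1 i).
pose a : 'rV[R]_(1 + 1) := row_mx (const_mx 1) 0.
pose b : 'rV[R]_(1 + 1) := row_mx 0 (const_mx 1).
have KP s t : K (s, t) = P (s *: a + t *: b).
  rewrite /P /= !linearD !linearZ /= /a /b !row_mxKl !row_mxKr !mxE.
  by rewrite !mulr1 !mulr0 addr0 add0r.
have [dP ddP] := P2.
have d1 (f : 'rV[R]_(1 + 1) -> R) y v : differentiable f y ->
    derive1 (fun s : R => f (y + s *: v)) 0 = 'd f y v.
  move=> df; have := @is_derive_line R _ f y v 0; rewrite scale0r addr0.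
  by move=> /(_ df)/is_derive_derive1.
have inner_t s : derive1 (fun t => K (s, t)) 0 = 'd P (0 + s *: a) b.
  by under eq_fun do rewrite KP; rewrite d1 ?add0r//; exact: dP.
have inner_s t : derive1 (fun s => K (s, t)) 0 = 'd P (0 + t *: b) a.
  by under eq_fun do rewrite KP addrC; rewrite d1 ?add0r//; exact: dP.
under eq_fun do rewrite inner_t; under [in RHS]eq_fun do rewrite inner_s.
rewrite (d1 (fun y => 'd P y b)); last exact: (ddP b).1.
rewrite (d1 (fun y => 'd P y a)); last exact: (ddP a).1.
exact: schwarz.
Qed.

End MixedDerivatives.

Section LieGroup.
Context {R : realType}.
Variables (d : nat) (G : pointedTopGroupType) (AG : set (chart R d G)).
Hypothesis hG : lie_group AG.

Notation line := (@line_atlas R).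
Let hA : smooth_atlas AG. Proof. by have [[]] := hG. Qed.
Let cA := smooth_atlas_cover hA.
Let hL := @line_smooth_atlas R.
Let cL := @line_cover R.

Section Ops.
Variables (n : nat) (M : topologicalType) (A : set (chart R n M)).
Hypothesis cM : chart_cover A.

Lemma Ck_map_mul k (f g : M -> G) : Ck_map k A AG f -> Ck_map k A AG g ->
  Ck_map k A AG (fun x => f x * g x)%g.
Proof.
move=> fk gk; have [_ hmul _] := hG.
exact: (Ck_map_comp cM (prod_atlas_cover cA cA) cA (Ck_map_pair cM cA cA fk gk)
  (hmul k)).
Qed.

Lemma Ck_map_inv k (f : M -> G) : Ck_map k A AG f ->
  Ck_map k A AG (fun x => (f x)^-1)%g.
Proof.
by move=> fk; have [_ _ hinv] := hG; exact: (Ck_map_comp cM cA cA fk (hinv k)).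
Qed.

Lemma Ck_fun_comp k (f : M -> G) (u : G -> R) : Ck_map k A AG f ->
  Ck_fun AG k u -> Ck_fun A k (u \o f).
Proof.
move=> fk /(Ck_map_funP cA) uk; apply/(Ck_map_funP cM).
exact: (Ck_map_comp cM cA cL fk uk).
Qed.

End Ops.

Lemma smooth_mul_left g : smooth_map AG AG (fun h : G => g * h)%g.
Proof.
by move=> k; apply: Ck_map_mul => //; [exact: Ck_map_cst|exact: (Ck_map_id hA)].
Qed.

Lemma smooth_mul_right g : smooth_map AG AG (fun h : G => h * g)%g.
Proof.
by move=> k; apply: Ck_map_mul => //; [exact: (Ck_map_id hA)|exact: Ck_map_cst].
Qed.

Lemma smooth_conj g : smooth_map AG AG (fun h : G => g * h * g^-1)%g.
Proof.
by move=> k; apply: Ck_map_mul => //; [exact: smooth_mul_left|exact: Ck_map_cst].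
Qed.

Lemma smooth_fun_comp (psi : G -> G) (u : G -> R) :
  smooth_map AG AG psi -> smooth_map AG line u -> smooth_map AG line (u \o psi).
Proof. by move=> sp su k; exact: (Ck_map_comp cA cA cL (sp k) (su k)). Qed.

(** A velocity vanishes on functions that are not smooth, so transporting it by [psi]
    requires smoothness to be both preserved and reflected. *)
Lemma smooth_fun_comp_bij (psi psi' : G -> G) (u : G -> R) :
  smooth_map AG AG psi -> smooth_map AG AG psi' -> cancel psi' psi ->
  smooth_map AG line (u \o psi) <-> smooth_map AG line u.
Proof.
move=> sp sp' pK; split=> [su|]; last exact: smooth_fun_comp.
have -> : u = (u \o psi) \o psi' by apply/funext => x /=; rewrite pK.
exact: smooth_fun_comp.
Qed.

Lemma smooth_fun_mul_left g (u : G -> R) :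
  smooth_map AG line (fun h => u (g * h)%g) <-> smooth_map AG line u.
Proof.
apply: (@smooth_fun_comp_bij _ (fun h => g^-1 * h)%g u (smooth_mul_left g)
  (smooth_mul_left _)).
by move=> h /=; rewrite mulgA mulgV mul1g.
Qed.

Lemma smooth_fun_mul_right g (u : G -> R) :
  smooth_map AG line (fun h => u (h * g)%g) <-> smooth_map AG line u.
Proof.
apply: (@smooth_fun_comp_bij _ (fun h => h * g^-1)%g u (smooth_mul_right g)
  (smooth_mul_right _)).
by move=> h /=; rewrite -mulgA mulVg mulg1.
Qed.

Lemma smooth_fun_conj g (u : G -> R) :
  smooth_map AG line (fun h => u (g * h * g^-1)%g) <-> smooth_map AG line u.
Proof.
apply: (@smooth_fun_comp_bij _ (fun h => g^-1 * h * g^-1^-1)%g u (smooth_conj g)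
  (smooth_conj _)).
by move=> h /=; rewrite !mulgA mulgV mul1g invgK -mulgA mulgV mulg1.
Qed.

Lemma Ad1 (Z : functional R G) : Ad 1%g Z = Z.
Proof.
apply/funext => f; rewrite /Ad /Defs.pushforward; congr (Z _).
by apply/funext => h /=; rewrite mul1g invg1 mulg1.
Qed.

Lemma AdM g k (Z : functional R G) : Ad (g * k)%g Z = Ad g (Ad k Z).
Proof.
apply/funext => f; rewrite /Ad /Defs.pushforward; congr (Z _).
by apply/funext => h /=; rewrite invgM !mulgA.
Qed.

Lemma Ad_velocity g (gamma : R -> G) :
  Ad g (velocity AG gamma) = velocity AG (fun t => g * gamma t * g^-1)%g.
Proof.
apply/funext => f; rewrite /Ad /Defs.pushforward /velocity.
congr (if _ then _ else _); apply/asbool_equiv_eq; exact: smooth_fun_conj.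
Qed.

Lemma Ad_lie_algebra g Z : lie_algebra AG Z -> lie_algebra AG (Ad g Z).
Proof.
move=> [gamma [gk g0] <-]; exists (fun t => g * gamma t * g^-1)%g.
  split; last by rewrite g0 mulg1 mulgV.
  exact: (Ck_map_comp cL cA cA gk (smooth_conj g 1)).
by rewrite Ad_velocity.
Qed.

(** For smooth [u] and Z the velocity of a smooth curve gamma, this is the t-derivative at
    0 of the smooth function u (g gamma(t) g^-1) of (g, t). *)
Lemma Ad_continuous Z u : lie_algebra AG Z -> continuous (fun g : G => Ad g Z u : R).
Proof.
move=> /(tangent_smooth_curve hA)[gamma [sg g0 ->]].
have -> : (fun g => Ad g (velocity AG gamma) u : R) =
    (fun g => velocity AG (fun t => g * gamma t * g^-1)%g u).
  by apply/funext => g; rewrite Ad_velocity.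
rewrite /velocity; case: asboolP => [su|_]; last exact: cst_continuous.
apply: (Ck_fun_continuous cA (k := 0)).
apply: (@Ck_fun_partial R _ _ AG cA 0 (fun p => u (p.1 * gamma p.2 * p.1^-1)%g)).
have cP := prod_atlas_cover cA cL.
have f1 : Ck_map 1 (prod_atlas AG line) AG fst := Ck_map_fst hA hL 1.
have f2 : Ck_map 1 (prod_atlas AG line) AG (gamma \o snd).
  exact: (Ck_map_comp cP cL cA (Ck_map_snd hA hL 1) (sg 1)).
apply: (@Ck_fun_comp _ _ _ cP 1 (fun p : G * R => p.1 * gamma p.2 * p.1^-1)%g).
  apply: (Ck_map_mul cP); last exact: (Ck_map_inv cP).
  exact: (Ck_map_mul cP).
exact: (smooth_Ck_fun hA).
Qed.

Lemma lie_algebra0 : lie_algebra AG 0.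
Proof.
exists (fun=> 1%g); first by split=> //; exact: Ck_map_cst.
apply/funext => f; rewrite /velocity; case: ifP => // _.
exact: derive1_cst.
Qed.

Lemma velocity_cst0 (gamma : R -> G) : velocity AG gamma (fun=> 0) = 0.
Proof. by rewrite /velocity; case: ifP => // _; exact: derive1_cst. Qed.

(** If Z is fixed by Ad, differentiating f (g h) in h along Z amounts to differentiating
    f (h g). With Z and W the velocities of smooth curves gamma and sigma, the two terms
    of the bracket are then the two iterated derivatives of f (gamma(s) sigma(t)). *)
Lemma Ad_fixed_center : Ad_fixed AG `<=` lie_center AG.
Proof.
move=> Z [lZ AdZ]; split=> // W lW; apply/funext => f.
rewrite /lie_bracket -[RHS]/(0 : R^o).
have cP := prod_atlas_cover cL cL.
have [gamma [sg _ Zg]] := tangent_smooth_curve hA lZ.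
have [sigma [ss _ Ws]] := tangent_smooth_curve hA lW.
have [sf|nsf] := pselect (smooth_map AG line f); last first.
  (* translates of f are not smooth either, so both inner derivatives vanish *)
  have nW g : W (fun h => f (g * h)%g) = 0.
    by rewrite Ws /velocity asboolF// => /smooth_fun_mul_left.
  have nZ g : Z (fun h => f (g * h)%g) = 0.
    by rewrite Zg /velocity asboolF// => /smooth_fun_mul_left.
  under [X in Z X]eq_fun do rewrite nW; under [X in W X]eq_fun do rewrite nZ.
  by rewrite Zg Ws !velocity_cst0 subrr.
have ZE g : Z (fun h => f (g * h)%g) = derive1 (fun s => f (gamma s * g)%g : R^o) 0.
  rewrite -{1}(AdZ g^-1%g) /Ad /Defs.pushforward.
  rewrite [X in Z X](_ : _ = fun h => f (h * g)%g).
    by rewrite Zg velocity_smooth//; exact/smooth_fun_mul_right.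
  by apply/funext => h /=; rewrite invgK !mulgA mulgV mul1g.
have WE g : W (fun h => f (g * h)%g) = derive1 (fun t => f (g * sigma t)%g : R^o) 0.
  by rewrite Ws velocity_smooth//; exact/smooth_fun_mul_left.
have cPG := prod_atlas_cover cA cL.
have Gfst k : Ck_map k (prod_atlas AG line) AG fst := Ck_map_fst hA hL k.
have Gsnd k (c : R -> G) : smooth_map line AG c ->
    Ck_map k (prod_atlas AG line) AG (c \o snd).
  by move=> sc; exact: (Ck_map_comp cPG cL cA (Ck_map_snd hA hL k) (sc k)).
have sZ : smooth_map AG line (fun g => derive1 (fun s => f (gamma s * g)%g : R^o) 0).
  apply/(smooth_mapP hA) => k.
  apply: (@Ck_fun_partial R _ _ AG cA k (fun p => f (gamma p.2 * p.1)%g)).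
  apply: (@Ck_fun_comp _ _ _ cPG _ (fun p : G * R => gamma p.2 * p.1)%g).
    by apply: (Ck_map_mul cPG) => //; exact: Gsnd.
  exact: (smooth_Ck_fun hA).
have sW : smooth_map AG line (fun g => derive1 (fun t => f (g * sigma t)%g : R^o) 0).
  apply/(smooth_mapP hA) => k.
  apply: (@Ck_fun_partial R _ _ AG cA k (fun p => f (p.1 * sigma p.2)%g)).
  apply: (@Ck_fun_comp _ _ _ cPG _ (fun p : G * R => p.1 * sigma p.2)%g).
    by apply: (Ck_map_mul cPG) => //; exact: Gsnd.
  exact: (smooth_Ck_fun hA).
under [X in Z X]eq_fun do rewrite WE; under [X in W X]eq_fun do rewrite ZE.
rewrite Zg Ws !velocity_smooth//.
apply/eqP; rewrite subr_eq0; apply/eqP.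
apply: (derive1_swap (K := fun p => f (gamma p.1 * sigma p.2)%g)).
apply: (@Ck_fun_comp _ _ _ cP _ (fun p : R * R => gamma p.1 * sigma p.2)%g).
  apply: (Ck_map_mul cP).
    exact: (Ck_map_comp cP cL cA (Ck_map_fst hL hL 2) (sg 2)).
  exact: (Ck_map_comp cP cL cA (Ck_map_snd hL hL 2) (ss 2)).
exact: (smooth_Ck_fun hA).
Qed.

Section Cocycle.
Variables (n : nat) (X : ptopologicalType) (AX : set (chart R n X)).
Hypothesis hX : smooth_atlas AX.
Variables (F : R -> X -> X) (phi : X -> G).
Hypotheses (hF : C1_flow AX F) (hphi : Ck_map 1 AX AG phi).
Let cX := smooth_atlas_cover hX.

(** Right translation moves the derivative of phi along the orbit to the identity. *)
Lemma M_cocycle_velocity x :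
  M_cocycle AG F phi x = velocity AG (fun t => phi (F t x) * (phi x)^-1)%g.
Proof.
apply/funext => f; rewrite /M_cocycle /lie_derivative /Defs.pushforward /velocity.
congr (if _ then _ else _); apply/asbool_equiv_eq; exact: smooth_fun_mul_right.
Qed.

Lemma flow_at_Ck x : Ck_map 1 line AX (F ^~ x).
Proof.
have [_ _ Fk] := hF.
have cP := prod_atlas_cover cL cX.
have cLl : Ck_map 1 line line id := Ck_map_id hL 1.
exact: (Ck_map_comp cL cP cX (Ck_map_pair cL cL cX cLl (Ck_map_cst _ _ _ x)) Fk).
Qed.

Lemma M_cocycle_lie_algebra x : lie_algebra AG (M_cocycle AG F phi x).
Proof.
rewrite M_cocycle_velocity; exists (fun t => phi (F t x) * (phi x)^-1)%g => //.
have [F0 _ _] := hF; split; last by rewrite F0 mulgV.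
apply: (Ck_map_mul cL); last exact: Ck_map_cst.
exact: (Ck_map_comp cL cX cA (flow_at_Ck x) hphi).
Qed.

(** For smooth [u], this is the t-derivative at 0 of u (phi(F_t x) phi(x)^-1), which is of
    class C^1 in (x, t). *)
Lemma M_cocycle_continuous u : continuous (fun x => M_cocycle AG F phi x u : R).
Proof.
under eq_fun do rewrite M_cocycle_velocity.
rewrite /velocity; case: asboolP => [su|_]; last exact: cst_continuous.
apply: (Ck_fun_continuous cX (k := 0)).
apply: (@Ck_fun_partial R _ _ AX cX 0
  (fun p => u (phi (F p.2 p.1) * (phi p.1)^-1)%g)).
have cP := prod_atlas_cover cX cL.
have cP' := prod_atlas_cover cL cX.
have [_ _ Fk] := hF.
have f1 : Ck_map 1 (prod_atlas AX line) AX fst := Ck_map_fst hX hL 1.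
have f2 : Ck_map 1 (prod_atlas AX line) line snd := Ck_map_snd hX hL 1.
have f3 : Ck_map 1 (prod_atlas AX line) AX (fun p => F p.2 p.1).
  exact: (Ck_map_comp cP cP' cX (Ck_map_pair cP cL cX f2 f1) Fk).
apply: (@Ck_fun_comp _ _ _ cP 1
  (fun p : X * R => phi (F p.2 p.1) * (phi p.1)^-1)%g).
  apply: (Ck_map_mul cP); first exact: (Ck_map_comp cP cX cA f3 hphi).
  by apply: (Ck_map_inv cP); exact: (Ck_map_comp cP cX cA f1 hphi).
exact: (smooth_Ck_fun hA).
Qed.

End Cocycle.
End LieGroup.

(** * Zero-one laws and unique ergodicity *)

Section Borel.
Context {R : realType}.

Lemma borel_measurable_fun (T : ptopologicalType) (f : T -> R) :
  continuous f -> measurable_fun [set: borel T] (f : borel T -> R).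
Proof.
move=> /continuousP cf; apply: (measurability _ (RGenOpens.measurableE R)).
move=> _ [_ [a [b ->] <-]]; rewrite setTI.
by apply: sub_sigma_algebra; apply: cf; exact: interval_open.
Qed.

Lemma borel_measurable_map (T U : ptopologicalType) (f : T -> U) :
  continuous f -> measurable_fun [set: borel T] (f : borel T -> borel U).
Proof.
move=> /continuousP cf.
apply: (@measurability _ _ (borel T) (borel U) setT f (@open U) erefl).
by move=> _ [B oB <-]; rewrite setTI; apply: sub_sigma_algebra; exact: cf.
Qed.

End Borel.

Section ZeroOne.
Context {R : realType} d (T : measurableType d).

Lemma full_setC (P : {measure set T -> \bar R}) (A : set T) :
  P setT = 1%E -> measurable A -> P A = 1%E -> P (~` A) = 0%E.
Proof.
move=> P1 mA PA; rewrite -setTD measureD//; last by rewrite [ltLHS]P1 ltry.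
by rewrite setTI [X in (X - _)%E]P1 [X in (_ - X)%E]PA subee.
Qed.

(** [E] is obtained by removing the null sets of the family and the complements of its
    full sets; its points belong to the same members of the family. *)
Lemma zero_one_sets (P : {measure set T -> \bar R}) (I : countType) (A : I -> set T) :
  P setT = 1%E -> (forall i, measurable (A i)) ->
  (forall i, P (A i) = 0%E \/ P (A i) = 1%E) ->
  exists E, [/\ measurable E, P (~` E) = 0%E &
    forall i x y, E x -> E y -> A i x -> A i y].
Proof.
move=> P1 mA A01.
pose B i := if `[< P (A i) = 0%E >] then A i else ~` A i.
have mB i : measurable (B i).
  by rewrite /B; case: ifP => _ //; exact: measurableC.
have B0 i : P (B i) = 0%E.
  rewrite /B; case: asboolP => // PA0; apply: full_setC => //.
  by case: (A01 i).
pose C n := if unpickle n is Some i then B i else set0.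
have mC n : measurable (C n) by rewrite /C; case: unpickle.
have C0 n : P.-negligible (C n).
  rewrite /C; case: unpickle => [i|]; last exact: negligible_set0.
  by apply/negligibleP; [exact: mB|exact: B0].
have mU : measurable (\bigcup_n C n) by exact: bigcupT_measurable.
exists (~` \bigcup_n C n); split; first exact: measurableC.
  by rewrite setCK; apply/(negligibleP _ mU); exact: negligible_bigcup.
move=> i x y Ex Ey Aix.
have notB z : (~` \bigcup_n C n) z -> ~ B i z.
  by move=> Ez Bz; apply: Ez; exists (pickle i) => //; rewrite /C pickleK.
move: (notB _ Ex) (notB _ Ey); rewrite /B; case: ifP => _; first by move/(_ Aix).
by move=> _ /contrapT.
Qed.

(** Conditioning on an invariant set of positive measure yields another invariant
    probability measure; by uniqueness it equals [P], so the set has full measure. *)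
Lemma uniquely_ergodic_ergodic (P : {measure set T -> \bar R}) (f : T -> T) :
  P setT = 1%E -> uniquely_ergodic f P -> ergodic f P.
Proof.
move=> P1 [invP uniqP] A mA fA.
have [->|PA0] := eqVneq (P A) 0%E; [by left|right].
have PAle : (P A <= 1)%E by rewrite -P1 le_measure// inE.
have PAfin : P A \is a fin_num.
  by rewrite ge0_fin_numE// (le_lt_trans PAle)// ltry.
pose Q : probability T R := mnormalize (mrestr P mA) (dirac point).
have rT : mrestr P mA setT = P A by rewrite /mrestr setTI.
have QE B : Q B = (P (B `&` A) * (fine (P A))^-1%:E)%E.
  rewrite /Q /= /mnormalize /= rT (negbTE PA0) /= ifF//.
  by move: PAfin; rewrite ge0_fin_numE// => /lt_eqF.
have invQ : invariant_measure f Q.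
  move=> B mB; rewrite !QE; congr (_ * _)%E.
  rewrite -{1}fA -preimage_setI; apply: invP; exact: measurableI.
rewrite -(uniqP Q invQ A mA) QE setIid -{1}(fineK PAfin) -EFinM divff//.
by rewrite fine_eq0.
Qed.

End ZeroOne.

(** * Invariant functions of an ergodic skew product *)

Section Aux.
Context {R : realType}.

Lemma ae_exists d (T : measurableType d) (P : probability T R) (Q : T -> Prop) :
  {ae P, forall x, Q x} -> exists x, Q x.
Proof.
move=> [N [mN N0 QN]]; apply: contrapT => nQ.
have NT : N = setT.
  by apply/seteqP; split=> // x _; apply: QN => /= Qx; apply: nQ; exists x.
by move: N0; rewrite NT probability_setT => /eqP; rewrite onee_eq0.
Qed.

Lemma le_rat_inj (a b : R) : (forall q : rat, a <= ratr q <-> b <= ratr q) -> a = b.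
Proof.
move=> ab; apply/eqP; rewrite eq_le; apply/andP; split; rewrite leNgt; apply/negP.
  move=> /rat_in_itvoo[q]; rewrite in_itv/= => /andP[bq qa].
  by have := (ab q).2 (ltW bq); rewrite leNgt qa.
move=> /rat_in_itvoo[q]; rewrite in_itv/= => /andP[aq qb].
by have := (ab q).1 (ltW aq); rewrite leNgt qb.
Qed.

Lemma product_null_section d1 d2 (T1 : measurableType d1) (T2 : measurableType d2)
    (P1 : probability T1 R) (P2 : probability T2 R) (E : set (T1 * T2)) :
  measurable E -> (P1 \x P2)%E E = 0%E ->
  {ae P1, forall x, P2 (xsection E x) = 0%E}.
Proof.
move=> mE E0.
pose f : T1 -> \bar R := P2 \o xsection E.
have mf : measurable_fun setT f by exact: measurable_fun_xsection.
have : (\int[P1]_(x in setT) `|f x| = 0)%E.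
  by rewrite -[RHS]E0; apply: eq_integral => x _; rewrite gee0_abs.
move=> /(ae_eq_integral_abs P1 measurableT mf)[N [mN N0 sub]].
exists N; split=> // x nx; apply: sub => /= xP; exact/nx/xP.
Qed.

Lemma product_probability_setT d1 d2 (T1 : measurableType d1)
    (T2 : measurableType d2) (P1 : probability T1 R) (P2 : probability T2 R) :
  (P1 \x P2)%E setT = 1%E.
Proof.
rewrite -setXTT product_measure1E// -[RHS]mule1.
by congr (_ * _)%E; exact: probability_setT.
Qed.

Lemma Rintegral_sum d (T : measurableType d) (mu : probability T R) k
    (f : 'I_k -> T -> R) (b : 'I_k -> R) :
  (forall i, mu.-integrable setT (EFin \o f i)) ->
  mu.-integrable setT (EFin \o (fun x => \sum_(i < k) f i x * b i)) /\
  Rintegral mu setT (fun x => \sum_(i < k) f i x * b i) =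
  \sum_(i < k) Rintegral mu setT (f i) * b i.
Proof.
elim: k f b => [|k IH] f b intf.
  split.
    have := integrable0 mu setT; congr (integrable _ _ _).
    by apply/funext => x /=; rewrite big_ord0.
  rewrite big_ord0 /Rintegral integral0_eq// => x _.
  by rewrite big_ord0.
have [I1 I2] := IH (fun i => f (widen_ord (leqnSn k) i))
  (fun i => b (widen_ord (leqnSn k) i)) (fun i => intf _).
have I3 : mu.-integrable setT (EFin \o (fun x => f ord_max x * b ord_max)).
  have := integrableZr measurableT (b ord_max) (intf ord_max).
  by congr (integrable _ _ _).
have eqf : (fun x => \sum_(i < k.+1) f i x * b i) =
  (fun x => (\sum_(i < k) f (widen_ord (leqnSn k) i) x * b (widen_ord (leqnSn k) i))
      + f ord_max x * b ord_max).
  by apply/funext => x; rewrite big_ord_recr.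
rewrite eqf; split.
  have := integrableD measurableT I1 I3; congr (integrable _ _ _).
rewrite RintegralD// I2 RintegralZr//.
by rewrite big_ord_recr.
Qed.

End Aux.

Section Main.
Variables (R : realType) (X : ptopologicalType) (muX : probability (borel X) R).
Variables (d : nat) (G : pointedTopGroupType) (AG : set (chart R d G)).
Hypothesis hG : lie_group AG.
Variable muG : probability (borel G) R.
Hypothesis hmuG : normalised_haar muG.
Variables (F : R -> X -> X) (phi : X -> G).

(** The translate of [S] by the inverse of [k] has full measure as well, so it meets [S]. *)
Lemma haar_meets_translate (S : set (borel G)) (k : G) : measurable S ->
  muG (~` S) = 0%E -> exists g : G, S g /\ S (k * g)%g.
Proof.
move=> mS S0; apply: contrapT => noG.
have kcont : continuous (fun g : G => k * g)%g by have [] := smooth_mul_left hG k 0.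
pose S' : set (borel G) := [set (k^-1 * h)%g | h in (S : set G)].
have S'E : S' = (fun g : borel G => (k * (g : G))%g : borel G) @^-1` S.
  apply/seteqP; split=> [_ [h Sh <-]|g Sg] /=; first by rewrite mulgA mulgV mul1g.
  by exists (k * g)%g => //; rewrite mulgA mulVg mul1g.
have mS' : measurable S'.
  rewrite S'E -[X in measurable X]setTI.
  exact: (borel_measurable_map kcont measurableT mS).
have muS : muG S = 1%E.
  have := probability_setC muG (measurableC mS).
  by rewrite setCK S0 sube0.
have : (muG S' <= muG (~` S))%E.
  apply: le_measure; rewrite ?inE//; first exact: measurableC.
  by rewrite S'E => g /= Skg Sg; apply: noG; exists g.
by rewrite (hmuG k^-1%g mS) muS S0 leNgt lte01.
Qed.

Hypotheses (F0 : forall x, F 0 x = x) (FD : forall s t x, F (s + t) x = F s (F t x)).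
Hypothesis Fcont : forall t, continuous (F t).
Hypothesis hFmu : forall t : R, invariant_measure (F t : borel X -> borel X) muX.

(** [ergodic] speaks of sets that are exactly invariant, whereas invariance of the degree
    holds almost everywhere: the exceptional null set is replaced by the union of its
    preimages under all integer times of the flow. *)
Lemma invariant_null_hull (N : set (borel X)) : measurable N -> muX N = 0%E ->
  exists N' : set (borel X), [/\ measurable N', muX N' = 0%E, N `<=` N' &
    forall x, N' (F 1 x) <-> N' x].
Proof.
move=> mN N0.
pose C j : set (borel X) :=
  if unpickle j is Some k then (F (k : int)%:~R : borel X -> borel X) @^-1` N else set0.
have inC x : (\bigcup_j C j) x <-> exists k : int, N (F k%:~R x).
  split=> [[j _]|[k Nk]]; last by exists (pickle k) => //; rewrite /C pickleK.
  by rewrite /C; case: unpickle => [k|//] Nk; exists k.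
have mC j : measurable (C j).
  rewrite /C; case: unpickle => [k|//]; rewrite -[X in measurable X]setTI.
  exact: (borel_measurable_map (@Fcont _) measurableT mN).
have C0 j : muX.-negligible (C j).
  apply/negligibleP; first exact: mC.
  rewrite /C; case: unpickle => [k|]; last exact: measure0.
  by rewrite -N0; exact: hFmu.
have mU : measurable (\bigcup_j C j) by exact: bigcupT_measurable.
exists (\bigcup_j C j); split=> //.
- by apply/(negligibleP _ mU); exact: negligible_bigcup.
- by move=> x Nx; apply/inC; exists 0; rewrite mulr0z F0.
- move=> x; split=> /inC[k Nk]; apply/inC.
    by exists (k + 1); rewrite rmorphD /= FD.
  by exists (k - 1); rewrite rmorphB /= -FD subrK.
Qed.

(** The map (x, g) |-> Ad_g (p x) is invariant under the skew product because p is fixed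
    by W, so its sublevel sets, taken coordinate by coordinate at rational levels, have
    measure 0 or 1, and it is almost everywhere equal to a constant c. Translating in the
    fibre shows that Ad fixes c, and then p x = c for almost every x. *)
Lemma ergodic_cocycle_invariant_constant (p : X -> functional R G) :
  ergodic (skew_product F phi) (muX \x muG)%E ->
  (forall x, lie_algebra AG (p x)) ->
  (forall u : G -> R, measurable_fun [set: borel X] (fun x : borel X => p x u : R)) ->
  {ae muX, forall x, W_op F phi p x = p x} ->
  exists2 c, Ad_fixed AG c & {ae muX, forall x, p x = c}.
Proof.
move=> ergT lp mp [N0 [mN0 N00 subN0]].
have [N [mN N_0 N0N NF]] := invariant_null_hull mN0 N00.
have hA : smooth_atlas AG by have [[]] := hG.
have [k [u [e [le_ basis]]]] := tangent_space_basis hA 1%g.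
pose h i (z : borel X * borel G) : R := Ad (z.2 : G) (p z.1) (u i).
have hE i z : h i z = \sum_(j < k) (p z.1 (u j) : R) * (Ad (z.2 : G) (e j) (u i) : R).
  rewrite /h /Ad /Defs.pushforward {1}(basis (p z.1) (lp _)) fct_sumE.
  by apply: eq_bigr.
have mh i : measurable_fun setT (h i).
  rewrite (funext (hE i)).
  apply: measurable_sum => j; apply: measurable_funM.
    exact: (@measurableT_comp _ _ _ _ _ _ (fun x : borel X => p x (u j) : R) _ fst
      (mp (u j)) measurable_fst).
  have mAd : measurable_fun [set: borel G]
      (fun g : borel G => Ad (g : G) (e j) (u i) : R).
    by apply: borel_measurable_fun; exact: (Ad_continuous hG (le_ j)).
  exact: (@measurableT_comp _ _ _ _ _ _
      (fun g : borel G => Ad (g : G) (e j) (u i) : R) _ snd mAd measurable_snd).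
pose A (iq : 'I_k * rat) : set (borel X * borel G) :=
  fst @^-1` (~` N) `&` (h iq.1 @^-1` [set y | y <= ratr iq.2]).
have mA iq : measurable (A iq).
  apply: measurableI; rewrite -[X in measurable X]setTI.
    by apply: measurable_fst => //; exact: measurableC.
  rewrite (_ : [set y | y <= ratr iq.2] = `]-oo, ratr iq.2]%classic).
    by apply: mh => //; exact: measurable_itv.
  by apply/seteqP; split=> y /=; rewrite in_itv.
have TA iq : skew_product F phi @^-1` A iq = A iq.
  apply/seteqP; rewrite /A /h; split=> -[x g] [/= nN hle]; have nNx : ~ N x.
  - by move=> /NF.
  - split=> //; move: hle; rewrite AdM.
    by rewrite -[Ad (phi x) _]/(W_op F phi p x) (_ : W_op F phi p x = p x)//;
       apply: contrapT => nW; apply: nNx; apply: N0N; exact: subN0.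
  - by [].
  - split=> [/NF//|]; rewrite AdM.
    by rewrite -[Ad (phi x) _]/(W_op F phi p x) (_ : W_op F phi p x = p x)//;
       apply: contrapT => nW; apply: nNx; apply: N0N; exact: subN0.
have PT := product_probability_setT muX muG.
have [E [mE E0 sameA]] := zero_one_sets PT mA (fun iq => ergT _ (mA iq) (TA iq)).
have goodae : {ae muX, forall x, muG (xsection (~` E) x) = 0%E /\ ~ N x}.
  have aeN : {ae muX, forall x, ~ N x}.
    by exists N; split=> // x /contrapT.
  have aeE := product_null_section (measurableC mE) E0.
  by apply: filterS2 aeE aeN => x.
pose S x : set (borel G) := [set g | E (x, g)].
have SE x : ~` S x = xsection (~` E) x.
  by apply/seteqP; split=> g; rewrite /xsection /= ?inE ?in_setE.
have mS x : measurable (S x).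
  rewrite -[S x]setCK SE; apply: measurableC; apply: measurable_xsection.
  exact: measurableC.
have [x0 [S0 nN0]] := ae_exists goodae; rewrite -SE in S0.
have [g0 [Eg0 _]] := haar_meets_translate 1%g (mS x0) S0.
pose c := Ad (g0 : G) (p x0).
have cE x g : E (x, g) -> ~ N x -> Ad (g : G) (p x) = c.
  move=> Exg nNx.
  rewrite (basis _ (Ad_lie_algebra hG g (lp x))).
  rewrite [RHS](basis _ (Ad_lie_algebra hG g0 (lp x0))).
  apply: eq_bigr => i _; congr (_ *: _).
  apply: le_rat_inj => q; split=> hq.
    by have [] := sameA (i, q) _ (x0, g0) Exg Eg0; first by split.
  by have [] := sameA (i, q) (x0, g0) _ Eg0 Exg; first by split.
have Adc : forall g, Ad g c = c.
  move=> g; have [g1 [E1 Eg1]] := haar_meets_translate g (mS x0) S0.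
  by rewrite -{1}(cE _ _ E1 nN0) -AdM (cE _ _ Eg1 nN0).
exists c; first by split=> //; exact: Ad_lie_algebra.
apply: filterS goodae => x [Sx nNx]; rewrite -SE in Sx.
have [g [Exg _]] := haar_meets_translate 1%g (mS x) Sx.
rewrite -[RHS](Adc (g : G)^-1%g) -(cE _ _ Exg nNx) -AdM mulVg.
by rewrite (Ad1 (p x)).
Qed.

End Main.

(** * Projection onto the kernel of 1 - W, and the theorem *)

Section Projection.
Variables (R : realType) (n : nat) (X : ptopologicalType) (AX : set (chart R n X)).
Hypotheses (hX : smooth_atlas AX) (hXc : compact [set: X]).
Variable muX : probability (borel X) R.
Variables (d : nat) (G : pointedTopGroupType) (AG : set (chart R d G)).
Hypothesis hG : lie_group AG.
Variable ip : functional R G -> functional R G -> R.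
Hypothesis hip : scalar_product AG ip.
Variables (F : R -> X -> X) (phi : X -> G).
Hypotheses (hF : C1_flow AX F) (hphi : Ck_map 1 AX AG phi).

Lemma continuous_compact_integrable (f : X -> R) : continuous f ->
  muX.-integrable [set: borel X] (EFin \o (f : borel X -> R)).
Proof.
move=> cf; apply: measurable_bounded_integrable => //.
- exact: (le_lt_trans (probability_le1 muX measurableT) (ltry 1)).
- exact: borel_measurable_fun.
have [M0 [Mreal fM]] :=
  compact_bounded (continuous_compact (continuous_subspaceT cf) hXc).
by exists M0; split=> // M M0M x _; apply: (fM M M0M); exists x.
Qed.

Lemma ip_sum_coords k (u : 'I_k -> G -> R) (e : 'I_k -> functional R G)
    (c Z : functional R G) :
  (forall i, lie_algebra AG (e i)) -> lie_algebra AG c ->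
  ip (\sum_(i < k) Z (u i) *: e i) c = \sum_(i < k) Z (u i) * ip (e i) c.
Proof.
move=> le_ lc; have [_ ipl _] := hip.
have hA : smooth_atlas AG by have [[]] := hG.
have ip0 : ip 0 c = 0.
  have := ipl 1 0 0 c (lie_algebra0 AG) (lie_algebra0 AG) lc.
  rewrite scaler0 addr0 mul1r => /eqP.
  by rewrite -subr_eq subrr eq_sym => /eqP.
pose K (y : functional R G) (r : R) := lie_algebra AG y /\ ip y c = r.
suff [] : K (\sum_(i < k) Z (u i) *: e i) (\sum_(i < k) Z (u i) * ip (e i) c) by [].
apply: big_rec2 => [|i y r _ [ly <-]].
  by split=> //; exact: (lie_algebra0 AG).
by split; [exact: (tangent_space_linear hA _ (le_ i) ly)|exact: ipl].
Qed.

(** Since Ad fixes c, the constant function c lies in the kernel of 1 - W; hence M - p,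
    which is M - c almost everywhere, is orthogonal to it. *)
Lemma constant_projection_norm (p : X -> functional R G) (c : functional R G) :
  is_degree muX AG ip F phi p -> Ad_fixed AG c -> {ae muX, forall x, p x = c} ->
  lie_algebra AG (vector_integral muX (M_cocycle AG F phi)) ->
  ip (vector_integral muX (M_cocycle AG F phi)) c = ip c c.
Proof.
move=> [[[lp mp _] _] orth] [lc Adc] pc lV.
have [_ ipl _] := hip.
have hA : smooth_atlas AG by have [[]] := hG.
have [k [u [e [le_ basis]]]] := tangent_space_basis hA 1%g.
pose M := M_cocycle AG F phi.
have lM x : lie_algebra AG (M x) by exact: (M_cocycle_lie_algebra hG hX hF hphi).
have ipE Z : lie_algebra AG Z -> ip Z c = \sum_(i < k) Z (u i) * ip (e i) c.
  by move=> lZ; rewrite {1}(basis Z lZ) ip_sum_coords.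
have Kc : ker_one_minus_W muX AG ip F phi (fun=> c).
  split; last by apply: aeW => x; exact: Adc.
  split=> [x|u0|]; [exact: lc|exact: measurable_cst|].
  by rewrite integral_cst//= [X in (_ * X)%E](probability_setT muX) mule1 ltry.
have := orth _ Kc; rewrite /L2_dot.
have intM i : muX.-integrable [set: borel X]
    (EFin \o (fun x : borel X => M x (u i) : R)).
  by apply: continuous_compact_integrable; exact: (M_cocycle_continuous hG hX hF hphi).
have [intS intSE] := Rintegral_sum (fun i => ip (e i) c) intM.
pose a (x : borel X) : R := \sum_(i < k) M x (u i) * ip (e i) c.
pose b (x : borel X) : R := \sum_(i < k) p x (u i) * ip (e i) c.
have mb : measurable_fun [set: borel X] b.
  by apply: measurable_sum => i; apply: measurable_funM => //; exact: mp.
have ma : measurable_fun [set: borel X] a.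
  by apply/measurable_EFinP; exact: measurable_int intS.
have dotE x : ip ((M - p) x) c = a x - b x.
  rewrite -[(M - p) x]/(M x - p x) addrC -scaleN1r ipl// mulN1r addrC.
  by rewrite (ipE _ (lM x)) (ipE _ (lp x)).
have -> : Rintegral muX [set: borel X] (fun x => ip ((M - p) x) c) =
    Rintegral muX [set: borel X] (fun x => a x - ip c c).
  rewrite /Rintegral; congr fine.
  apply: ae_eq_integral => //.
  - rewrite (_ : (fun x => _) = EFin \o (fun x => a x - b x)).
      by apply/measurable_EFinP; exact: measurable_funB.
    by apply/funext => x /=; rewrite dotE.
  - by apply/measurable_EFinP; apply: measurable_funB.
  - have [N [mN N0 subN]] := pc; exists N; split=> // x npx; apply: subN => /= px.
    apply: npx => _; rewrite dotE; congr (_ - _)%:E.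
    by rewrite /b -ipE ?px.
rewrite RintegralB//; last first.
  by apply: continuous_compact_integrable; exact: cst_continuous.
rewrite Rintegral_cst// [fine _](congr1 fine (probability_setT muX)) mulr1 intSE => /eqP.
by rewrite subr_eq0 => /eqP <-; rewrite (ipE _ lV).
Qed.

End Projection.

Theorem theorem3p16 (R : realType)
  (n : nat) (X : ptopologicalType) (AX : set (chart R n X))
  (hX : smooth_manifold AX) (hXc : compact [set: X])
  (muX : probability (borel X) R)
  (F : R -> X -> X) (hF : C1_flow AX F)
  (hFmu : forall t : R, invariant_measure (F t : borel X -> borel X) muX)
  (d : nat) (G : pointedTopGroupType) (AG : set (chart R d G))
  (hG : lie_group AG) (hGc : compact [set: G])
  (muG : probability (borel G) R) (hmuG : normalised_haar muG)
  (ip : functional R G -> functional R G -> R)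
  (hip : scalar_product AG ip) (hipAd : Ad_invariant AG ip)
  (phi : X -> G) (hphi : Ck_map 1 AX AG phi)
  (deg : X -> functional R G) (hdeg : is_degree muX AG ip F phi deg)
  (hdeg0 : nonzero_on_positive_measure muX deg) :
  let T_phi := skew_product F phi in
  let assumption_a :=
    orthocomplement AG ip (Ad_fixed AG)
      (vector_integral muX (M_cocycle AG F phi)) in
  let assumption_b := connected [set: G] /\ lie_center AG = [set 0] in
  [/\ assumption_a -> ~ uniquely_ergodic T_phi (muX \x muG)%E,
      assumption_b -> ~ uniquely_ergodic T_phi (muX \x muG)%E &
      assumption_a \/ assumption_b ->
        uniquely_ergodic (F 1 : borel X -> borel X) muX ->
        ~ ergodic T_phi (muX \x muG)%E].
Proof.
move=> T_phi assumption_a assumption_b.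
have hXa : smooth_atlas AX by case: hX.
suff not_ergodic : assumption_a \/ assumption_b -> ~ ergodic T_phi (muX \x muG)%E.
  have PT := product_probability_setT muX muG.
  split=> [ha|hb|hab _]; last exact: not_ergodic.
    by move=> /(uniquely_ergodic_ergodic PT); apply: not_ergodic; left.
  by move=> /(uniquely_ergodic_ergodic PT); apply: not_ergodic; right.
move=> hab ergT.
have [F0 FD [Fcont _]] := hF.
have Ftcont t : continuous (F t).
  move=> x; apply: (@continuous_comp _ _ _ (pair t) (fun p : R * X => F p.1 p.2)).
    exact: (cvg_pair (cvg_cst t) cvg_id).
  exact: Fcont.
have [[[ldeg mdeg _] Wdeg] _] := hdeg.
have [c Adc degc] := ergodic_cocycle_invariant_constant hG hmuG F0 FD Ftcont hFmu
  ergT ldeg mdeg Wdeg.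
have c0 : c = 0.
  case: hab => [[lV orth]|[_ center0]]; last first.
    by have := Ad_fixed_center hG Adc; rewrite center0.
  apply: contrapT => c0; have [_ _ /(_ c Adc.1 c0)] := hip.
  rewrite -(constant_projection_norm hXa hXc hG hip hF hphi hdeg Adc degc lV).
  by rewrite orth// ltxx.
have [X0 [mX0 X0pos degX0]] := hdeg0.
have [N [mN N0 subN]] := degc.
have : (muX X0 <= muX N)%E.
  apply: le_measure; rewrite ?inE// => x X0x; apply: subN => /= degx.
  by apply: (degX0 _ X0x); rewrite degx c0.
by rewrite N0 leNgt X0pos.
Qed.
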